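(* The joint system of the qDE and qKZ equations for $\mathbb P^{n-1}$, $$\frac d{dq}Y(q,z)=\mathcal A(q,z)Y(q,z),\qquad Y(q,z_1,\dots,z_j-1,\dots,z_n)=\widetilde K_j(q,z)Y(q,z),\quad j=1,\dots,n,$$ is equivalent at $q=\infty$, up to the change of variable $q=s^n$, to the system $$\frac{dZ}{ds}=UZ,\qquad Z(s,z_1,\dots,z_j-1,\dots,z_n)=\mathcal K_jZ(s,z),\quad j=1,\dots,n,$$ where, with $\zeta_n=\exp(2\pi\sqrt{-1}/n)$, $$U=\mathrm{diag}(n\zeta_n^0,\dots,n\zeta_n^{n-1}),\qquad \mathcal K_j=\mathrm{diag}\big(\zeta_n^0,\zeta_n^{-1},\dots,\zeta_n^{-(n-1)}\big),\quad j=1,\dots,n.$$ Here equivalence means: there is a formal transformation $Y(s^n,z)=G(s,z)Z(s,z)$, with $G(s,z)=\mathcal H(s^n)\mathcal E^{-1}F(s,z)s^{\Lambda(z)}$ and $F(s,z)=\mathbf 1+\sum_{k\ge1}\widetilde F_k(z)s^{-k}$ a formal power series in $s^{-1}$ with coefficients polynomial in $z$, transforming the first system into the second.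
   Context: Fix $n\ge2$. $H^\bullet_{\mathbb T}(\mathbb P^{n-1},\mathbb C)\cong\mathbb C[x,z]/\langle\prod_i(x-z_i)\rangle$, $\mathbb T=(\mathbb C^* )^n$, $z=(z_1,\dots,z_n)$; bases over $\mathbb C[z]$: $x_\alpha=x^\alpha$ ($\alpha=0,\dots,n-1$) and $g_i=\prod_{a=i+1}^n(x-z_a)$ ($i=1,\dots,n$, $g_n=1$). $s_i$ are the elementary symmetric polynomials. $q\mathcal A(q,z)$ is the matrix in the basis $(x_\alpha)$ of the operator $x*_{q,z}$: $x*_{q,z}x_j=x_{j+1}$ for $0\le j\le n-2$, $x*_{q,z}x_{n-1}=q+\sum_{i=1}^n(-1)^{i-1}s_i(z)x_{n-i}$. $R_{ab}(u)$ ($a\ne b$) and $E_i$ are the $\mathbb C[z]$-linear operators $R_{ab}(u)g_i=g_i$ ($i\ne a,b$), $R_{ab}(u)g_b=g_a$, $R_{ab}(u)g_a=g_b+ug_a$, $E_ig_j=\delta_{ij}g_j$, and $$K_i(q,z)=R_{i,i-1}(z_i-z_{i-1}-1)\cdots R_{i,1}(z_i-z_1-1)\,q^{-E_i}\,R_{i,n}(z_i-z_n)\cdots R_{i,i+1}(z_i-z_{i+1}).$$ $\widetilde K_i(q,z)$ is the matrix, with respect to the basis $(x_\alpha)$ at $z$ (source) and at $z^-_i=(z_1,\dots,z_i-1,\dots,z_n)$ (target), of the composition of $K_i(q,z)$ with the linear map sending $g_j$ at $z$ to $g_j$ at $z^-_i$ for all $j$. $\mathcal H(s^n)=\mathrm{diag}(1,s^{-1},\dots,s^{-(n-1)})$;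 $\mathcal E_{i\alpha}=\frac1{\sqrt n}\exp\big(\frac{(i-1)(2\alpha-1)\pi\sqrt{-1}}n\big)$, $i,\alpha=1,\dots,n$; $\Lambda(z)=\big(s_1(z)+\frac{n-1}2\big)\mathbf 1$. ''Transforms'' means $G^{-1}\big(ns^{n-1}\mathcal A(s^n,z)\big)G-G^{-1}\frac{dG}{ds}=U$ and $G(s,z^-_j)^{-1}\widetilde K_j(s^n,z)G(s,z)=\mathcal K_j$. *)

(* Defs.v *)
From HB Require Import structures.
From mathcomp Require Import all_boot all_order all_algebra.
From mathcomp Require Import complex mpoly.
From mathcomp Require Import boolp classical_sets cardinality fsbigop.
From mathcomp Require Import reals sequences trigo.
From mathcomp Require Import ring.

Set Implicit Arguments.
Unset Strict Implicit.
Unset Printing Implicit Defensive.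

Import Order.TTheory GRing.Theory Num.Theory.
Local Open Scope classical_set_scope.
Local Open Scope ring_scope.

(* The ring of formal series sum_l c_l s^l, where both the exponents l and the
   coefficients c_l are polynomials in z = (z_1, ..., z_n), and where the
   exponents that occur lie in finitely many sets {e, e - 1, e - 2, ...}.
   It contains the Laurent series in s^-1 over C[z] and the formal powers
   s^l for every l in C[z]. *)
Section GSeries.
Variables (C : numFieldType) (n : nat).
Local Notation K := {mpoly C[n]}.

Definition descending_support (f : K -> K) : Prop :=
  exists E : seq K, forall l, f l != 0 ->
    exists2 e, e \in E & exists k : nat, l = e - k%:R.

Record gseries : Type := GSeries {
  gcoef :> K -> K;
  gcoef_descending : descending_support gcoef }.

HB.instance Definition _ := gen_eqMixin gseries.
HB.instance Definition _ := gen_choiceMixin gseries.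

Implicit Types (f g h : gseries) (l m : K).

Lemma gseriesP f g : (forall l, f l = g l) -> f = g.
Proof.
case: f g => [f Hf] [g Hg] /= /funext E; case: _ / E in Hg *.
by congr GSeries; exact: Prop_irrelevance.
Qed.

Lemma mpoly_natr_inj : injective (fun k : nat => k%:R : K).
Proof.
move=> i j /(congr1 (mcoeff 0%MM)); rewrite !raddfMn /= !mcoeff1 eqxx /= => /eqP.
by rewrite eqr_nat => /eqP.
Qed.

Lemma mpoly_natr_bound (D : seq K) :
  exists M : nat, forall k : nat, k%:R \in D -> (k <= M)%N.
Proof.
elim: D => [|d D [M HM]]; first by exists 0%N.
have [[j Hj]|Hd] := pselect (exists j : nat, j%:R = d).
  exists (maxn M j) => k; rewrite inE => /orP[/eqP Hk|/HM Hk].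
    by rewrite leq_max; apply/orP; right; rewrite (mpoly_natr_inj (etrans Hk (esym Hj))).
  by rewrite leq_max Hk.
exists M => k; rewrite inE => /orP[/eqP Hk|/HM //].
by case: Hd; exists k.
Qed.

Let gzero_proof : descending_support (fun=> 0).
Proof. by exists [::] => l; rewrite eqxx. Qed.
Definition gzero := GSeries gzero_proof.

Let gopp_proof f : descending_support (fun l => - f l).
Proof. by case: f => f [E HE] /=; exists E => l; rewrite oppr_eq0 => /HE. Qed.
Definition gopp f := GSeries (gopp_proof f).

Let gadd_proof f g : descending_support (fun l => f l + g l).
Proof.
case: f g => f [E HE] [g [E' HE']] /=; exists (E ++ E') => l.
have [->|/HE [e eE Hl _]] := eqVneq (f l) 0; last first.
  by exists e => //; rewrite mem_cat eE.
by rewrite add0r => /HE' [e eE Hl]; exists e => //; rewrite mem_cat eE orbT.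
Qed.
Definition gadd f g := GSeries (gadd_proof f g).

Lemma gaddA : associative gadd.
Proof. by move=> f g h; apply: gseriesP => l /=; rewrite addrA. Qed.
Lemma gaddC : commutative gadd.
Proof. by move=> f g; apply: gseriesP => l /=; rewrite addrC. Qed.
Lemma gadd0 : left_id gzero gadd.
Proof. by move=> f; apply: gseriesP => l /=; rewrite add0r. Qed.
Lemma gaddN : left_inverse gzero gopp gadd.
Proof. by move=> f; apply: gseriesP => l /=; rewrite addNr. Qed.

HB.instance Definition _ :=
  GRing.isZmodule.Build gseries gaddA gaddC gadd0 gaddN.

(* The sum has finitely many nonzero terms, by [gmul_finite]. *)
Definition gconv f g (l : K) : K := \sum_(m \in [set: K]) f m * g (l - m).

Lemma fsum_seq (F : K -> K) (X : seq K) : (forall m, F m != 0 -> m \in X) ->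
  \sum_(m \in [set: K]) F m = \sum_(m <- undup X) F m.
Proof.
move=> HX; rewrite (fsbigE (undup X)) ?undup_uniq//.
  by apply: eq_bigl => m; rewrite in_setT.
move=> m _; rewrite mem_undup => /negP Hm; apply/eqP/negPn/negP.
by move=> /HX.
Qed.

Lemma fsum_neq0 (F : K -> K) :
  \sum_(m \in [set: K]) F m != 0 -> exists m, F m != 0.
Proof.
move=> H; apply: contrapT => Hn; case/eqP: H; apply: fsbig1 => m _.
by apply: contrapT => Hm; apply: Hn; exists m; apply/eqP.
Qed.

Lemma gmul_finite3 f g h l : exists A B : seq K,
  forall m m', f m * g (m' - m) * h (l - m') != 0 -> m \in A /\ m' \in B.
Proof.
case: f g h => f [E HE] [g [E' HE']] [h [E'' HE'']] /=.
have [M HM] := mpoly_natr_bound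
  [seq e - l | e <- [seq e + e'' | e <- [seq e + e' | e <- E, e' <- E'], e'' <- E'']].
exists [seq e - k%:R | e <- E, k <- iota 0 M.+1].
exists [seq e - k%:R | e <- [seq e + e' | e <- E, e' <- E'], k <- iota 0 M.+1].
move=> m m'; rewrite !mulf_eq0 !negb_or => /andP[/andP[]].
move=> /HE[e eE [k Hk]] /HE'[e' eE' [k' Hk']] /HE''[e'' eE'' [k'' Hk'']].
have Hs : (k + k' + k'' <= M)%N.
  apply: HM; apply/mapP; exists (e + e' + e'').
    by apply: allpairs_f => //; apply: allpairs_f.
  have -> : l = (l - m') + ((m' - m) + m) by rewrite !subrK.
  by rewrite Hk'' Hk' Hk !natrD; ring.
split.
  rewrite Hk; apply: (allpairs_f (fun (e : K) (k : nat) => e - k%:R)) => //.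
  by rewrite mem_iota /= add0n ltnS (leq_trans _ Hs)// -addnA leq_addr.
have -> : m' = (e + e') - (k + k')%:R.
  by rewrite -(subrK m m') Hk' Hk natrD; ring.
apply: (allpairs_f (fun (e : K) (k : nat) => e - k%:R)); first exact: allpairs_f.
by rewrite mem_iota /= add0n ltnS (leq_trans _ Hs)// leq_addr.
Qed.

Let gmono_proof (c m : K) : descending_support (fun l => if l == m then c else 0).
Proof.
exists [:: m] => l; have [-> _|_] := eqVneq l m; last by rewrite eqxx.
by exists m; rewrite ?inE//; exists 0%N; rewrite subr0.
Qed.
Definition gmono (c m : K) := GSeries (gmono_proof c m).

Lemma gmul_finite f g l : exists A : seq K,
  forall m, f m * g (l - m) != 0 -> m \in A.
Proof.
have [A [B H]] := gmul_finite3 f g (gmono 1 0) l.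
exists A => m Hm; have [] // := H m l _.
by rewrite subrr /= eqxx mulr1.
Qed.

Let gmul_proof f g : descending_support (gconv f g).
Proof.
case: (gcoef_descending f) (gcoef_descending g) => E HE [E' HE'].
exists [seq e + e' | e <- E, e' <- E'] => l /fsum_neq0[m].
rewrite mulf_eq0 negb_or => /andP[/HE[e eE [k Hk]] /HE'[e' eE' [k' Hk']]].
exists (e + e'); first exact: allpairs_f.
by exists (k + k')%N; rewrite -(subrK m l) Hk' Hk natrD; ring.
Qed.
Definition gmul f g := GSeries (gmul_proof f g).

Lemma gmulC : commutative gmul.
Proof.
move=> f g; apply: gseriesP => l /=; rewrite /gconv.
rewrite (reindex_fsbigT (fun m => l - m)) /=.
  by apply: eq_fsbigr => m _; rewrite subKr mulrC.
by exists (fun m => l - m) => m; rewrite subKr.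
Qed.

Lemma gmulA : associative gmul.
Proof.
move=> f g h; apply: gseriesP => l /=; rewrite /gconv /=.
have [A [B H]] := gmul_finite3 f g h l.
transitivity (\sum_(m <- undup A) \sum_(m' <- undup B)
    f m * g (m' - m) * h (l - m')).
  rewrite (fsum_seq (X := A)); last first.
    move=> m; rewrite mulr_fsumr => /fsum_neq0[r Hr].
    have [] // := H m (r + m) _.
    by rewrite addrK opprD addrA addrAC -mulrA.
  apply: eq_bigr => m _; rewrite mulr_fsumr.
  rewrite (reindex_fsbigT (fun m' => m' - m)) /=; last first.
    by exists (fun r => r + m) => r; rewrite ?addrK ?subrK.
  rewrite (fsum_seq (X := B)).
    by apply: eq_bigr => m' _; rewrite mulrA; congr (_ * h _); ring.
  move=> m' Hm'; have [] // := H m m' _.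
  by rewrite -mulrA (_ : l - m' = l - m - (m' - m))//; ring.
rewrite exchange_big /= (fsum_seq (X := B)); last first.
  by move=> m'; rewrite mulr_fsuml => /fsum_neq0[m Hm]; have [] := H m m' Hm.
apply: eq_bigr => m' _; rewrite mulr_fsuml (fsum_seq (X := A)) // => m Hm.
by have [] := H m m' Hm.
Qed.

Definition gone := gmono 1 0.

Lemma gmul1 : left_id gone gmul.
Proof.
move=> f; apply: gseriesP => l /=; rewrite /gconv (fsum_seq (X := [:: 0])).
  by rewrite big_seq1 /= eqxx mul1r subr0.
by move=> m /=; rewrite inE; case: (m == 0); rewrite ?mul0r ?eqxx.
Qed.

Lemma gmulD : left_distributive gmul gadd.
Proof.
move=> f g h; apply: gseriesP => l /=; rewrite /gconv.
have [A HA] := gmul_finite f h l; have [B HB] := gmul_finite g h l.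
rewrite !(fsum_seq (X := A ++ B)) => [|m|m|m] /=.
- by rewrite -big_split; apply: eq_bigr => m _; rewrite /= mulrDl.
- by move=> /HB; rewrite mem_cat => ->; rewrite orbT.
- by move=> /HA; rewrite mem_cat => ->.
rewrite mulrDl mem_cat; have [->|/HA -> //] := eqVneq (f m * h (l - m)) 0.
by rewrite add0r => /HB ->; rewrite orbT.
Qed.

Lemma gone_neq0 : gone != gzero.
Proof.
by apply/eqP => /(congr1 (fun f => gcoef f 0))/eqP; rewrite /= eqxx oner_eq0.
Qed.

HB.instance Definition _ := GRing.Zmodule_isComNzRing.Build gseries
  gmulA gmulC gmul1 gmulD gone_neq0.

Definition gunit : {pred gseries} := [pred f | `[< exists g, g * f = 1 >]].
Definition ginv f : gseries :=
  if pselect (exists g, g * f = 1) is left H then projT1 (cid H) else f.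

Lemma gmulVx : {in gunit, left_inverse 1 ginv *%R}.
Proof.
by move=> f /asboolP Hf; rewrite /ginv; case: pselect => // H; case: (cid H).
Qed.
Lemma gunitPl f g : g * f = 1 -> f \in gunit.
Proof. by move=> H; apply/asboolP; exists g. Qed.
Lemma ginv_out : {in [predC gunit], ginv =1 id}.
Proof.
move=> f; rewrite inE => /asboolPn H; rewrite /ginv.
by case: pselect => // H'; case: H.
Qed.

HB.instance Definition _ :=
  GRing.ComNzRing_hasMulInverse.Build gseries gmulVx gunitPl ginv_out.

(* The series c_0 + c_1 s^-1 + c_2 s^-2 + ... *)
Let gpowser_proof (c : nat -> K) : descending_support
  (fun l => \sum_(k \in [set k : nat | l = - k%:R]) c k).
Proof.
exists [:: 0] => l Hl; exists 0; rewrite ?inE//; apply: contrapT => Hn.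
case/eqP: Hl; apply: fsbig1 => k /= Hk; case: Hn; exists k.
by rewrite sub0r.
Qed.
Definition gpowser (c : nat -> K) : gseries := GSeries (gpowser_proof c).

Definition gconst (c : K) : gseries := gmono c 0.
Definition gpow (l : K) : gseries := gmono 1 l.
Definition gs : gseries := gpow 1.

Let gderiv_proof f : descending_support (fun l => (l + 1) * f (l + 1)).
Proof.
case: (gcoef_descending f) => E HE; exists E => l.
rewrite mulf_eq0 negb_or => /andP[_ /HE[e eE [k Hk]]]; exists e => //.
by exists k.+1; rewrite -[l](addrK 1) Hk -natr1 opprD addrA.
Qed.
(* d/ds *)
Definition gderiv f : gseries := GSeries (gderiv_proof f).

(* The substitution z_j := z_j + c in a polynomial. *)
Definition ztrans (c : C) (j : 'I_n) (p : K) : K :=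
  p \mPo [tuple 'X_i + (c *+ (i == j))%:MP | i < n].

Lemma ztransB c j : {morph ztrans c j : p q / p - q}.
Proof. by move=> p q; rewrite /ztrans comp_mpolyB. Qed.
Lemma ztrans_nat c j (k : nat) : ztrans c j k%:R = k%:R.
Proof. by rewrite /ztrans -mpolyC_nat comp_mpolyC. Qed.
Lemma ztransK c j : cancel (ztrans c j) (ztrans (- c) j).
Proof.
move=> p; rewrite /ztrans; elim/mpolyind: p => [|b m p _ _ IH].
  by rewrite !comp_mpoly0.
rewrite !comp_mpolyD IH !comp_mpolyZ; congr (_ *: _ + _).
rewrite mpolyXE_id !rmorph_prod /=; apply: eq_bigr => i _.
rewrite !rmorphXn /= comp_mpolyXU -tnth_nth tnth_mktuple; congr (_ ^+ _).
rewrite comp_mpolyD comp_mpolyC comp_mpolyXU -tnth_nth tnth_mktuple mulNrn mpolyCN.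
by rewrite addrNK.
Qed.

Let gshift_proof (j : 'I_n) f :
  descending_support (fun l => ztrans (-1) j (f (ztrans 1 j l))).
Proof.
case: (gcoef_descending f) => E HE; exists (map (ztrans (-1) j) E) => l Hl.
have /HE[e eE [k Hk]] : f (ztrans 1 j l) != 0.
  by apply: contra_neq Hl => ->; rewrite /ztrans comp_mpoly0.
exists (ztrans (-1) j e); first exact: map_f.
by exists k; rewrite -[l](ztransK 1 j) Hk ztransB ztrans_nat.
Qed.
(* The substitution z_j := z_j - 1, acting on coefficients and on exponents:
   c s^l becomes c(z_j - 1) s^(l(z_j - 1)). *)
Definition gshift (j : 'I_n) f : gseries := GSeries (gshift_proof j f).

End GSeries.

Arguments gs {C n}.

(* The operators below act on column vectors of coordinates: column l of the
   matrix of T holds the coordinates of the image of the l-th basis vector.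
   Indices are shifted by one: i : 'I_n stands for i + 1, and alpha : 'I_n for
   the exponent alpha of x_alpha = x^alpha. *)
Section QuantumDifference.
Variables (S : comUnitRingType) (n : nat).
Implicit Types (q u : S) (z : 'I_n -> S) (i j k l a b : 'I_n).

(* x * x_j = x_(j+1) if j < n-1, and
   x * x_(n-1) = q + \sum_(1 <= i <= n) (-1)^(i-1) s_i(z) x_(n-i). *)
Definition qA q z : 'M[S]_n := \matrix_(k, j)
  if (j.+1 < n)%N then (k == j.+1 :> nat)%:R
  else q * (k == 0 :> nat)%:R
       + \sum_(1 <= i < n.+1)
           (-1) ^+ i.-1 * (mesym n S i).@[z] * (k == (n - i)%N :> nat)%:R.

Definition calA q z : 'M[S]_n := q^-1 *: qA q z.

(* g_i as a polynomial in x, of degree n - i. *)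
Definition gpoly z i : {poly S} := \prod_(a < n | (i < a)%N) ('X - (z a)%:P).

(* Coordinates of the g_i in the basis (x_alpha). *)
Definition g_to_x z : 'M[S]_n := \matrix_(alpha, i) (gpoly z i)`_alpha.

(* Matrices in the basis (g_i). *)
Definition Rmx a b u : 'M[S]_n := \matrix_(k, l)
  if l == b then (k == a)%:R
  else if l == a then (k == b)%:R + u * (k == a)%:R
  else (k == l)%:R.

(* q^(-E_i), where E_i g_j = delta_ij g_j. *)
Definition qpowNE i q : 'M[S]_n := diag_mx (\row_j q ^- (i == j)).

Definition Kmx i q z : 'M[S]_n :=
  (\big[mulmx/1%:M]_(a <- rev (enum 'I_n) | (a < i)%N) Rmx i a (z i - z a - 1))
  *m qpowNE i q
  *m (\big[mulmx/1%:M]_(a <- rev (enum 'I_n) | (i < a)%N) Rmx i a (z i - z a)).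

Definition zminus i z : 'I_n -> S := fun k => z k - (k == i)%:R.

Definition Ktilde i q z : 'M[S]_n :=
  g_to_x (zminus i z) *m Kmx i q z *m invmx (g_to_x z).

End QuantumDifference.

Section JointSystems.
Variables (C : numFieldType) (n : nat).
Local Notation S := (gseries C n).

(* The equations dY/ds = ode Y and Y(z_1, ..., z_j - 1, ..., z_n) = dif_j Y. *)
Record joint_system := JointSystem {
  ode : 'M[S]_n;
  dif : 'I_n -> 'M[S]_n }.

(* Effect of the change of unknown Y = G Z, for invertible G. *)
Definition transforms (G : 'M[S]_n) (sysY sysZ : joint_system) : Prop :=
  [/\ G \in unitmx,
      invmx G *m ode sysY *m G - invmx G *m map_mx (@gderiv C n) G = ode sysZ
    & forall j, invmx (map_mx (gshift j) G) *m dif sysY j *m G = dif sysZ j].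

Definition zser (i : 'I_n) : S := gconst 'X_i.

(* The joint system of the qDE and qKZ equations, with q = s^n. *)
Definition qDE_qKZ : joint_system := JointSystem
  ((n%:R * gs ^+ n.-1) *: calA (gs ^+ n) zser)
  (fun j => Ktilde j (gs ^+ n) zser).

Definition mconst (M : 'M[C]_n) : 'M[S]_n :=
  map_mx (fun c => gconst c%:MP) M.

Definition mpowser (F : nat -> 'M[{mpoly C[n]}]_n) : 'M[S]_n :=
  \matrix_(a, b) gpowser (fun k => F k a b).

(* H(s^n) *)
Definition calH : 'M[S]_n := diag_mx (\row_j gs ^- j).

Definition Lambda : {mpoly C[n]} := mesym n C 1 + ((n%:R - 1) / 2)%:MP.

End JointSystems.

Section Constants.
Variable R : realType.
Local Open Scope complex_scope.

Definition cexp (w : R[i]) : R[i] :=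
  let: a +i* b := w in (expR a * cos b) +i* (expR a * sin b).

Definition zeta (n : nat) : R[i] := cexp (2 * pi%:C * 'i%C / n%:R).

Definition calE (n : nat) : 'M[R[i]]_n := \matrix_(i, alpha)
  (((Num.sqrt n%:R : R)^-1)%:C
   * cexp (i%:R * (2 * alpha.+1%:R - 1) * pi%:C * 'i%C / n%:R)).

Definition diagonal_system (n : nat) : joint_system R[i] n := JointSystem
  (mconst (diag_mx (\row_(a < n) (n%:R * zeta n ^+ a))))
  (fun=> mconst (diag_mx (\row_(a < n) (zeta n ^- a)))).

End Constants.

(* Main.v *)
From HB Require Import structures.
Require Import Defs.
From mathcomp Require Import all_boot all_order all_algebra.
From mathcomp Require Import perm complex mpoly.
From mathcomp Require Import boolp classical_sets fsbigop.
From mathcomp Require Import reals exp trigo.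
From mathcomp Require Import ring lra.

(** The theorem rests on a closed formula for the qKZ operators. Work in
   C[x, z] / (prod_a (x - z_a) - q), where x acts by the quantum multiplication.
   For each ordering of 1, ..., n there is a basis made of the products of the
   factors x - z_b over the final segments of the ordering, and
   R_{ia}(z_i - z_a) is exactly the change of basis that exchanges two
   neighbours i and a. The right half of the product K_i therefore moves i to
   the last place of the ordering, and the left half, in which z_i has become
   z_i - 1, moves it from the first place back home. When i is last, every
   basis vector except 1 has the factor x - z_i; when i is first, none has it
   except prod_{a <> i} (x - z_a), which is q / (x - z_i). So q^(-E_i) followed
   by these identifications is division by x - z_i:
   Ktilde_i(q, z) = (x *_{q,z} - z_i)^(-1), which is [qA_sub_mul_Ktilde].
   With this formula the compatibility of the qDE with the qKZ equations becomes
   a one-line matrix identity, [qDE_qKZ_compat].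

   The existence of F is the classical theory of an irregular singular point
   with distinct eigenvalues. After conjugation by H(s^n) the operator x / s is
   a polynomial in 1/s whose constant term is the cyclic permutation matrix
   ([qA_calH], [qA_inf0]); the Fourier matrix E diagonalizes it, so the leading
   coefficient of the equation is U. The residue matrix, after conjugation by E,
   has all its diagonal entries equal to 1/n times its trace, which is Lambda.
   These two facts make the recursion for the F_k solvable over C[z]
   ([formal_gauge]): the off-diagonal entries of F_(k+1) come from the
   coefficient of s^(-k-1), its diagonal entries from that of s^(-k-2).

   The difference equations then come for free from the differential one.
   Write G^- for G with z_j replaced by z_j - 1, and Z for the diagonal matrix
   of the zeta^(-a). By compatibility, (x - z_j) G^- Z solves the same
   differential equation as G, so the quotient T of the two satisfies
   T' = [U, T]. A formal series whose exponents descend cannot satisfy y' = u y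
   with u a nonzero constant, so T is diagonal and constant in s
   ([gauge_ratio]); comparing leading coefficients gives T = 1
   ([gauge_ratio_eq1]). Inverting x - z_j gives
   (G^-)^(-1) Ktilde_j G = Z. *)

Set Implicit Arguments.
Unset Strict Implicit.
Unset Printing Implicit Defensive.

Import Order.TTheory GRing.Theory Num.Theory.
Local Open Scope ring_scope.

(** * The qKZ operators invert quantum multiplication *)

Section InverseOfKtilde.
Variables (S : comUnitRingType) (n : nat).
Implicit Types (q u : S) (z : 'I_n -> S) (i j k l a b : 'I_n) (p : {poly S}).

Definition prodXz z : {poly S} := \prod_(a < n) ('X - (z a)%:P).

(** Specialized from the formula of Viete in independent variables over the
    integers. *)
Lemma prodXz_mesym z :
  prodXz z = \sum_(k < n.+1) ((-1) ^+ k * (mesym n S k).@[z]) *: 'X^(n - k).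
Proof.
pose f := mmap intr z : {mpoly int[n]} -> S.
have := congr1 (map_poly f) (Viete n).
rewrite rmorph_prod /= (eq_bigr (fun a => 'X - (z a)%:P)); last first.
  by move=> a _; rewrite rmorphB /= map_polyX map_polyC /= /f mmapX mmap1U.
rewrite -/(prodXz z) => ->; rewrite rmorph_sum /=; apply: eq_bigr => k _.
rewrite !map_polyZ /= map_polyXn scalerA rmorphXn rmorphN1 /=.
congr (_ * _ *: _); rewrite /f /mesym !rmorph_sum /=; apply: eq_bigr => h _.
by rewrite !rmorph_prod; apply: eq_bigr => a _; rewrite /= mmapX mmap1U mevalXU.
Qed.

Lemma prodXz_coef z (k : nat) : (k <= n)%N ->
  (prodXz z)`_(n - k) = (-1) ^+ k * (mesym n S k).@[z].
Proof.
rewrite -ltnS => kn; rewrite prodXz_mesym coef_sum (bigD1 (Ordinal kn)) //=.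
rewrite coefZ coefXn eqxx mulr1 big1 ?addr0 // => l ne_lk.
rewrite coefZ coefXn (_ : (_ == _) = false) ?mulr0 //; apply/eqP => E.
case/eqP: ne_lk; apply: val_inj => /=.
by rewrite -[LHS](@subKn l n) -1?ltnS // -E subKn // -ltnS.
Qed.

Lemma qAE q z k j : qA q z k j =
  (k == j.+1 :> nat)%:R + (j.+1 == n)%:R * (q * (k == 0%N :> nat)%:R - (prodXz z)`_k).
Proof.
rewrite mxE; have [jn|jn] := ltnP j.+1 n.
  by rewrite (ltn_eqF jn) mul0r addr0.
have -> : j.+1 = n by apply/eqP; rewrite eqn_leq jn andbT.
rewrite eqxx mul1r (ltn_eqF (ltn_ord k)) add0r; congr (_ + _).
have kn : (n - k <= n)%N by rewrite leq_subr.
have := prodXz_coef z kn; rewrite subKn ?(ltnW (ltn_ord k)) // => ->.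
have k0 : (0 < n - k)%N by rewrite subn_gt0.
rewrite (big_nat_widenl _ 0) //= big_mkord big_mkcond /=.
have ltk : (n - k < n.+1)%N by rewrite ltnS.
rewrite (bigD1 (Ordinal ltk)) //= subKn ?(ltnW (ltn_ord k)) // eqxx mulr1 k0 big1 ?addr0.
  have -> : (-1) ^+ (n - k) = - (-1) ^+ (n - k).-1 :> S.
    by rewrite -[in LHS](prednK k0) exprS mulN1r.
  by rewrite mulNr opprK.
move=> l ne_lk; case: ifP => // l0; rewrite (_ : (_ == _) = false) ?mulr0 //.
apply/eqP => E; case/eqP: ne_lk; apply: val_inj => /=.
by rewrite E subKn // -ltnS.
Qed.

Definition coord_col p : 'cV[S]_n := \col_k p`_k.

(** The remainder of X p modulo [prodXz z - q] differs from X p by at most one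
    multiple of this monic polynomial of degree n, fixed by the coefficient of
    degree n - 1 of p. This is what identifies [qA] with multiplication by x
    in the quantum ring. *)
Lemma qA_mul_coord_col q z p : (size p <= n)%N ->
  qA q z *m coord_col p = coord_col ('X * p - p`_n.-1 *: (prodXz z - q%:P)).
Proof.
move=> sp; apply/colP => k; rewrite !mxE.
have n0 : (0 < n)%N by apply: leq_ltn_trans (ltn_ord k).
under eq_bigr => j _ do rewrite qAE mxE mulrDl.
rewrite big_split /= !(coefB, coefXM, coefZ, coefC); congr (_ + _).
  case: (val k) (ltn_ord k) => [|k'] kn /=.
    by rewrite big1 // => j _; rewrite mul0r.
  rewrite (bigD1 (Ordinal (ltnW kn))) //= eqxx mul1r big1 ?addr0 // => j ne.
  rewrite eqSS (_ : (_ == _) = false) ?mul0r //; apply/eqP => E.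
  by case/eqP: ne; apply: val_inj.
have ltn : (n.-1 < n)%N by rewrite prednK.
rewrite (bigD1 (Ordinal ltn)) //= prednK // eqxx mul1r big1 ?addr0.
  by case: (val k == 0%N); rewrite /= ?mulr1n ?mulr0n; ring.
move=> j ne; rewrite (_ : (_ == _) = false) ?mul0r //; apply/eqP => E.
by case/eqP: ne; apply: val_inj; exact: (congr1 predn E).
Qed.

Definition coord_mx (f : 'I_n -> {poly S}) : 'M[S]_n := \matrix_(k, a) (f a)`_k.

Lemma eq_coord_mx f g : f =1 g -> coord_mx f = coord_mx g.
Proof. by move=> E; apply/matrixP => k a; rewrite !mxE E. Qed.

Lemma coord_mx_Rmx f i a u : coord_mx f *m Rmx i a u =
  coord_mx (fun l => if l == a then f i else
                   if l == i then f a + u *: f i else f l).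
Proof.
have sum1 b (F : 'I_n -> S) : \sum_k F k * (k == b)%:R = F b.
  by rewrite (bigD1 b) //= eqxx mulr1 big1 ?addr0 // => k /negPf ->; rewrite mulr0.
apply/matrixP => k l; rewrite !mxE.
under eq_bigr => b _ do rewrite !mxE.
case: (l == a); first by rewrite sum1.
case: (l == i); last by rewrite sum1.
under eq_bigr => b _ do rewrite mulrDr mulrCA.
by rewrite big_split -mulr_sumr !sum1 coefD coefZ.
Qed.

(** The basis attached to the ordering in which i has been pulled out and put
    back just before the indices >= m (those other than i). The position m = 0
    is the first place, m = n the last one, and m = i, m = i + 1 both give the
    usual ordering. *)
Definition moved z i (m : nat) (a : 'I_n) : {poly S} :=
  if a == i then \prod_(b < n | (m <= b)%N && (b != i)) ('X - (z b)%:P)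
  else (if (a < m)%N then 'X - (z i)%:P else 1)
       * \prod_(b < n | (a < b)%N && (b != i)) ('X - (z b)%:P).

Lemma moved_home z i : moved z i i =1 gpoly z.
Proof.
move=> a; rewrite /moved /gpoly; case: eqP => [->|/eqP ai].
  by apply: eq_bigl => b; rewrite ltn_neqAle eq_sym andbC.
have [lt_ai|le_ia] := ltnP a i; first by rewrite -bigD1.
rewrite mul1r; apply: eq_bigl => b.
by case: eqP => [->|]; rewrite ?andbT // ltnNge le_ia.
Qed.

Lemma moved_homeS z i : moved z i i.+1 =1 gpoly z.
Proof.
move=> a; rewrite -(moved_home z i) /moved; case: eqP => [_|/eqP ai].
  apply: eq_bigl => b; rewrite ltn_neqAle eq_sym (inj_eq val_inj).
  by case: (b != i); rewrite ?andbF.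
by rewrite ltnS [(a < i)%N]ltn_neqAle (inj_eq val_inj) ai.
Qed.

(** If Q is the product over the indices after both i and a, the new i-th
    vector is (X - z_a) Q = (X - z_i) Q + (z_i - z_a) Q: this is where the
    spectral parameter z_i - z_a comes from. *)
Lemma moved_step z i a : a != i ->
  coord_mx (moved z i a.+1) *m Rmx i a (z i - z a) = coord_mx (moved z i a).
Proof.
move=> ai; rewrite coord_mx_Rmx; apply: eq_coord_mx => l; rewrite /moved eqxx.
rewrite (negPf ai) ltnSn.
have [->|la] := eqVneq l a; first by rewrite (negPf ai) ltnn mul1r.
have [_|li] := eqVneq l i; last by rewrite ltnS [(l < a)%N]ltn_neqAle (inj_eq val_inj) la.
rewrite [RHS](bigD1 a) ?leqnn //=.
rewrite [in RHS](eq_bigl (fun b : 'I_n => (a < b)%N && (b != i))).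
  rewrite -mul_polyC polyCB; set P := \prod_(b < n | _) _; ring.
move=> b; rewrite ltn_neqAle (inj_eq val_inj) [a == b]eq_sym.
by case: (b == a); case: (b == i); rewrite ?andbF ?andbT.
Qed.

(** The indices decrease from left to right, as in the products of R-matrices,
    so that the first factor turns B_n into B_(n-1). *)
Lemma mulmx_telescope (P : pred 'I_n) (B : nat -> 'M[S]_n) (F : 'I_n -> 'M[S]_n) :
  (forall a, P a -> B a.+1 *m F a = B a) ->
  (forall a, ~~ P a -> B a.+1 = B a) ->
  B n *m \big[mulmx/1%:M]_(a <- rev (enum 'I_n) | P a) F a = B 0%N.
Proof.
move=> HB HB'; have H (k : nat) : (k <= n)%N ->
    B k *m \big[mulmx/1%:M]_(a <- rev (take k (enum 'I_n)) | P a) F a = B 0%N.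
  elim: k => [|k IH] kn; first by rewrite take0 big_nil mulmx1.
  rewrite (take_nth (Ordinal kn)) ?size_enum_ord // rev_rcons big_cons.
  have -> : nth (Ordinal kn) (enum 'I_n) k = Ordinal kn.
    by apply: val_inj; rewrite /= nth_enum_ord.
  case: ifPn => Pk; first by rewrite mulmxA (HB _ Pk) IH // ltnW.
  by rewrite (HB' _ Pk) IH // ltnW.
by have := H n (leqnn n); rewrite take_oversize // size_enum_ord.
Qed.

Lemma moved_Rprod_right z i :
  coord_mx (moved z i n)
    *m \big[mulmx/1%:M]_(a <- rev (enum 'I_n) | (i < a)%N) Rmx i a (z i - z a)
  = g_to_x z.
Proof.
pose B m := coord_mx (moved z i (maxn m i.+1)).
have -> : coord_mx (moved z i n) = B n by rewrite /B (maxn_idPl _).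
rewrite mulmx_telescope => [|a ia|a].
- by rewrite /B max0n; apply/matrixP => k l; rewrite !mxE moved_homeS.
- rewrite /B !(maxn_idPl _) // 1?ltnW // moved_step //.
  by rewrite neq_ltn ia orbT.
- by rewrite -leqNgt => ai; rewrite /B !(maxn_idPr _) // ltnW.
Qed.

Lemma moved_Rprod_left z i :
  g_to_x z
    *m \big[mulmx/1%:M]_(a <- rev (enum 'I_n) | (a < i)%N) Rmx i a (z i - z a)
  = coord_mx (moved z i 0).
Proof.
pose B m := coord_mx (moved z i (minn m i)).
have -> : g_to_x z = B n.
  rewrite /B (minn_idPr _) 1?ltnW //.
  by apply/matrixP => k l; rewrite !mxE moved_home.
rewrite mulmx_telescope => [|a ai|a].
- by rewrite /B min0n.
- rewrite /B !(minn_idPl _) // 1?ltnW // moved_step //.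
  by rewrite neq_ltn ai.
- by rewrite -leqNgt => ia; rewrite /B !(minn_idPr _) // ltnW.
Qed.

Lemma gpolyE z i : exists2 s : seq S, gpoly z i = \prod_(c <- s) ('X - c%:P)
  & size s = (n - i.+1)%N.
Proof.
exists [seq z a | a <- index_enum 'I_n & (i < a)%N].
  by rewrite big_map big_filter.
rewrite size_map size_filter -sum1_count.
rewrite -(big_mkord (fun m : nat => i < m)%N (fun=> 1%N)).
rewrite -(big_nat_widenl _ _ _ predT (fun=> 1%N)) //.
by rewrite sum_nat_const_nat muln1.
Qed.

(** Since g_i is monic of degree n - 1 - i, reversing the rows gives a
    unitriangular matrix. *)
Lemma g_to_x_unit z : g_to_x z \in unitmx.
Proof.
pose s : 'S_n := perm (@rev_ord_inj n).
have trig : is_trig_mx (row_perm s (g_to_x z)).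
  apply/is_trig_mxP => a i ai; rewrite !mxE permE /=.
  have [t -> st] := gpolyE z i; rewrite nth_default //.
  by rewrite size_prod_XsubC st ltn_sub2l // (leq_ltn_trans _ (ltn_ord i)).
have : \det (row_perm s (g_to_x z)) = 1.
  rewrite det_trig // big1 // => i _; rewrite !mxE permE /=.
  have [t E st] := gpolyE z i.
  have /monicP := monic_prod_XsubC t xpredT id; rewrite lead_coefE.
  by rewrite size_prod_XsubC st E.
rewrite row_permE det_mulmx => E; rewrite unitmxE.
by apply/unitrPr; exists (\det (perm_mx s)); rewrite mulrC.
Qed.

Lemma size_prod_XsubC_cond z (P : pred 'I_n) :
  size (\prod_(b | P b) ('X - (z b)%:P)) = #|P|.+1.
Proof.
rewrite -(big_filter (index_enum 'I_n)) -(big_map z predT (fun c => 'X - c%:P)).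
rewrite size_prod_XsubC size_map size_filter; congr _.+1.
by rewrite -sum1_count -sum1_card.
Qed.

Lemma qA_sub_coord_mx q z (c : S) (f : 'I_n -> {poly S}) k a : (size (f a) <= n)%N ->
  ((qA q z - c%:M) *m coord_mx f) k a
  = (('X - c%:P) * f a - (f a)`_n.-1 *: (prodXz z - q%:P))`_k.
Proof.
move=> /(qA_mul_coord_col q z) /colP /(_ k); rewrite mxE [RHS]mxE => E.
rewrite mulmxBl mul_scalar_mx mulrBl addrAC coefB -E mul_polyC coefZ !mxE.
by congr (_ - _); apply: eq_bigr => b _; rewrite !mxE.
Qed.

(** Multiplication by x - z_i takes the basis with i in front at z^-_i to the
    basis with i at the end at z, up to a factor q on the i-th vector: there,
    the product of all the X - z_a is reduced to q. The family with i in front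
    does not involve z_i, so the shift of z_i by 1 is harmless. *)
Lemma qA_sub_mul_moved z i q : q \is a GRing.unit ->
  (qA q z - (z i)%:M) *m coord_mx (moved (zminus i z) i 0) *m qpowNE i q
  = coord_mx (moved z i n).
Proof.
move=> qu; apply/matrixP => k a.
have E (P : pred 'I_n) : \prod_(b < n | P b && (b != i)) ('X - (zminus i z b)%:P)
    = \prod_(b < n | P b && (b != i)) ('X - (z b)%:P).
  by apply: eq_bigr => b /andP[_ bi]; rewrite /zminus (negPf bi) subr0.
have cardC : #|predC1 i| = n.-1 by rewrite cardC1 card_ord.
have n1 : n.-1.+1 = n by rewrite prednK // (leq_ltn_trans _ (ltn_ord k)).
rewrite mul_mx_diag mxE [(\row_j _) _ _]mxE [RHS]mxE.
have [->|ai] := eqVneq a i.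
  have sp : size (moved (zminus i z) i 0 i) = n.
    by rewrite /moved eqxx E size_prod_XsubC_cond cardC.
  rewrite qA_sub_coord_mx ?sp // expr1.
  have -> : (moved (zminus i z) i 0 i)`_n.-1 = 1.
    rewrite -{2}sp -lead_coefE /moved eqxx.
    exact/monicP/monic_prod_XsubC.
  rewrite /moved eqxx E /= -(bigD1 i (P := predT)) //= scale1r opprB addrCA subrr addr0.
  rewrite big_pred0 ?coefC => [|b]; last by rewrite leqNgt ltn_ord.
  by case: ifP => _; rewrite ?mul0r ?divrr.
have sp : (size (moved (zminus i z) i 0 a) < n)%N.
  rewrite /moved (negPf ai) mul1r E size_prod_XsubC_cond -[X in (_ < X)%N]n1 ltnS -cardC.
  apply/proper_card/properP; split.
    by apply/fintype.subsetP => b; rewrite !inE => /andP[].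
  by exists a; rewrite ?inE //= unfold_in ltnn.
rewrite qA_sub_coord_mx ?(ltnW sp) // invr1 mulr1 [_`_n.-1]nth_default; last first.
  by rewrite -ltnS n1.
by rewrite scale0r subr0 /moved (negPf ai) mul1r E ltn_ord.
Qed.

(** The key formula: Ktilde_i(q, z) is the inverse of x - z_i acting by
    quantum multiplication. *)
Lemma qA_sub_mul_Ktilde z i q : q \is a GRing.unit ->
  (qA q z - (z i)%:M) *m Ktilde i q z = 1%:M.
Proof.
move=> qu; rewrite /Ktilde /Kmx.
have EL : g_to_x (zminus i z) *m
    \big[mulmx/1%:M]_(a <- rev (enum 'I_n) | (a < i)%N) Rmx i a (z i - z a - 1)
    = coord_mx (moved (zminus i z) i 0).
  rewrite -moved_Rprod_left; congr (_ *m _); apply: eq_bigr => a ai.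
  have ne_ai : a != i by rewrite neq_ltn ai.
  by rewrite /zminus eqxx (negPf ne_ai) subr0 addrAC.
rewrite !mulmxA -(mulmxA _ (g_to_x _)) EL qA_sub_mul_moved // moved_Rprod_right.
by rewrite mulmxV // g_to_x_unit.
Qed.

Lemma Ktilde_mul_qA_sub z i q : q \is a GRing.unit ->
  Ktilde i q z *m (qA q z - (z i)%:M) = 1%:M.
Proof. by move=> qu; apply: mulmx1C; exact: qA_sub_mul_Ktilde. Qed.

(** Changing z_i into z_i - 1 changes the polynomial of the z_a by P, the
    product of the X - z_a over a <> i; and (X - z_i) P reduces to q in the
    quantum ring. Together with d/dq of [qA] this is the whole content of the
    compatibility of the qDE with the i-th qKZ equation. *)
Lemma qA_sub_mul_shift_diff z i q :
  (qA q z - (z i)%:M) *m (qA q (zminus i z) - qA q z)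
  = \matrix_(k, j) (- q * ((k == 0%N :> nat) && (j.+1 == n))%:R).
Proof.
pose P := \prod_(b < n | b != i) ('X - (z b)%:P).
have EP : prodXz (zminus i z) = ('X - (z i)%:P + 1) * P.
  rewrite /prodXz (bigD1 i) //= /zminus eqxx polyCB.
  congr (_ * _); first by rewrite mulr1n; ring.
  by apply: eq_bigr => b /negPf ->; rewrite subr0.
have Ez : prodXz z = ('X - (z i)%:P) * P by rewrite /prodXz (bigD1 i).
have ED : qA q (zminus i z) - qA q z
    = coord_mx (fun j => - ((j.+1 == n)%:R *: P)).
  apply/matrixP => k j; rewrite mxE [(- qA q z) _ _]mxE !qAE mxE EP Ez mulrDl mul1r.
  by rewrite coefD coefN coefZ; ring.
(* Only the last column of the difference is nonzero, and it consists of the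
   coefficients of - P, of degree n - 1. *)
rewrite ED; apply/matrixP => k j; rewrite [RHS]mxE.
have sP : size P = n.
  rewrite size_prod_XsubC_cond cardC1 card_ord prednK //.
  exact: leq_ltn_trans (ltn_ord i).
have P1 : P`_n.-1 = 1 by rewrite -sP -lead_coefE; apply/monicP/monic_prod_XsubC.
rewrite qA_sub_coord_mx ?size_polyN; last by rewrite (leq_trans (size_scale_leq _ _)) ?sP.
rewrite coefN coefZ P1 mulrN -scalerAr -Ez !(coefB, coefN, coefZ, coefC).
by case: (val k == 0%N); case: (j.+1 == n); rewrite /= ?mulr1n ?mulr0n; ring.
Qed.

End InverseOfKtilde.

(** * Calculus of formal series in s *)

Section GSeriesCalculus.
Variables (C : numFieldType) (n : nat).
Local Notation K := {mpoly C[n]}.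
Local Notation S := (gseries C n).
Implicit Types (f g : S) (c l m : K).

Lemma gcoefM f g l : (f * g) l = gconv f g l. Proof. by []. Qed.

Lemma gcoef_sum I (r : seq I) (P : pred I) (F : I -> S) l :
  (\sum_(i <- r | P i) F i) l = \sum_(i <- r | P i) F i l.
Proof. by apply: (big_morph (fun f : S => f l)). Qed.

Lemma gcoef_monoM c m f l : (gmono c m * f) l = c * f (l - m).
Proof.
rewrite gcoefM /gconv (fsum_seq (X := [:: m])) ?big_seq1 /= ?eqxx // => p.
by rewrite inE /=; case: (p == m); rewrite ?mul0r ?eqxx.
Qed.

Lemma gmonoM c d l m : gmono c l * gmono d m = gmono (c * d) (l + m).
Proof.
apply: gseriesP => p; rewrite gcoef_monoM /= subr_eq addrC.
by case: eqP; rewrite ?mulr0.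
Qed.

Lemma gpowD l m : gpow (l + m) = gpow l * gpow m :> S.
Proof. by rewrite gmonoM mulr1. Qed.

Lemma gpow_unit l : gpow l \is a @GRing.unit S.
Proof. by apply/unitrP; exists (gpow (- l)); rewrite -!gpowD addNr subrr. Qed.

Lemma gpowV l : (gpow l)^-1 = gpow (- l) :> S.
Proof.
by apply: (mulrI (gpow_unit l)); rewrite divrr ?gpow_unit // -gpowD subrr.
Qed.

Lemma gsX k : gs ^+ k = gpow k%:R :> S.
Proof. by elim: k => // k IH; rewrite exprS IH -gpowD -natr1 addrC. Qed.

Lemma gconst_is_zmod_morphism : zmod_morphism (@gconst C n).
Proof. by move=> c d; apply: gseriesP => l /=; case: eqP; rewrite ?subr0. Qed.
Lemma gconst_is_monoid_morphism : monoid_morphism (@gconst C n).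
Proof. by split=> // c d; rewrite /gconst gmonoM addr0. Qed.
HB.instance Definition _ :=
  GRing.isZmodMorphism.Build K S (@gconst C n) gconst_is_zmod_morphism.
HB.instance Definition _ :=
  GRing.isMonoidMorphism.Build K S (@gconst C n) gconst_is_monoid_morphism.

Lemma gcoef_constM c f l : (gconst c * f) l = c * f l.
Proof. by rewrite gcoef_monoM subr0. Qed.

Lemma gcoef_powM m f l : (gpow m * f) l = f (l - m).
Proof. by rewrite gcoef_monoM mul1r. Qed.

Lemma gderiv_is_zmod_morphism : zmod_morphism (@gderiv C n).
Proof. by move=> f g; apply: gseriesP => l /=; rewrite mulrBr. Qed.
HB.instance Definition _ :=
  GRing.isZmodMorphism.Build S S (@gderiv C n) gderiv_is_zmod_morphism.

Lemma gderivM f g : gderiv (f * g) = gderiv f * g + f * gderiv g.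
Proof.
apply: gseriesP => l; rewrite /= /gconv.
have [A HA] := gmul_finite f g (l + 1).
rewrite [X in _ = X + _](reindex_fsbigT (fun m => m - 1)) /=; last first.
  by exists (fun m => m + 1) => m; rewrite ?subrK ?addrK.
rewrite !(fsum_seq (X := A)) => [|m|m|m].
- rewrite mulr_sumr -big_split; apply: eq_bigr => m _ /=.
  have -> : l - (m - 1) = l + 1 - m by ring.
  have -> : l - m + 1 = l + 1 - m by ring.
  by rewrite subrK; ring.
- rewrite !mulf_eq0 !negb_or => /and3P[fm _ gm].
  by apply: HA; rewrite mulf_neq0 // addrAC.
- rewrite subrK !mulf_eq0 !negb_or => /andP[/andP[_ fm] gm].
  by apply: HA; rewrite mulf_neq0 // -addrA -[1 - m]opprB.
- exact: HA.
Qed.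

Lemma gderiv_const c : gderiv (gconst c) = 0.
Proof. by apply: gseriesP => l /=; case: eqP => [->|]; rewrite ?mul0r ?mulr0. Qed.

Lemma gderiv_pow l : gderiv (gpow l) = gconst l * gpow (l - 1).
Proof.
apply: gseriesP => m; rewrite gcoef_constM /= eq_sym -subr_eq eq_sym.
by case: eqP => [->|]; rewrite ?subrK ?mulr0.
Qed.

Lemma gderiv_eq0 f : gderiv f = 0 -> f = gconst (f 0).
Proof.
move=> f'0; apply: gseriesP => l /=; case: eqP => [->//|/eqP l0].
have /eqP := congr1 (fun g : S => g (l - 1)) f'0.
by rewrite /= subrK mulf_eq0 (negPf l0) => /eqP.
Qed.

(** Comparing coefficients of s^l, (l + 1) f_(l+1) = u f_l with u <> 0, so one
    nonzero coefficient forces nonzero ones at l + 1, l + 2, ..., against the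
    support being bounded above along l + Z. This is the formal counterpart of
    the fact that exp(u s) has an essential singularity at infinity. *)
Lemma gderiv_eigen f (u : C) : u != 0 -> gderiv f = gconst u%:MP * f -> f = 0.
Proof.
move=> u0 f'E; apply: gseriesP => l; apply/eqP/negPn/negP => fl.
have step k : f (l + k%:R) != 0.
  elim: k => [|k]; first by rewrite addr0.
  apply: contraNneq => E; have := congr1 (fun g : S => g (l + k%:R)) f'E.
  rewrite gcoef_constM /= -addrA natr1 E mulr0 => /esym/eqP.
  by rewrite mulf_eq0 mpolyC_eq0 (negPf u0).
have [E HE] := gcoef_descending f.
(* The support reaches l + M + 1 = e - k, so e - l is a natural number larger
   than M, a bound for the natural numbers of this form. *)
have [M HM] := mpoly_natr_bound [seq e - l | e <- E].
have [e eE [k Hk]] := HE _ (step M.+1).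
have /HM : (M.+1 + k)%:R \in [seq e - l | e <- E].
  apply/mapP; exists e => //; rewrite natrD; apply/eqP.
  by rewrite eq_sym subr_eq addrC addrA Hk subrK.
by rewrite leqNgt ltnS leq_addr.
Qed.

Lemma ztrans0 (b : C) j : ztrans b j 0 = 0 :> K.
Proof. exact: ztrans_nat b j 0%N. Qed.
Lemma ztrans1 (b : C) j : ztrans b j 1 = 1 :> K.
Proof. exact: ztrans_nat b j 1%N. Qed.
Lemma ztransD (b : C) j : {morph @ztrans C n b j : p q / p + q}.
Proof. by move=> p q; rewrite /ztrans comp_mpolyD. Qed.
Lemma ztransM (b : C) j (p q : K) : ztrans b j (p * q) = ztrans b j p * ztrans b j q.
Proof. exact: rmorphM. Qed.
Lemma ztransKV (b : C) j : cancel (ztrans (- b) j) (@ztrans C n b j).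
Proof. by move=> p; rewrite -{1}[b]opprK ztransK. Qed.

Lemma ztransN (b : C) j : {morph @ztrans C n b j : p / - p}.
Proof. by move=> p; rewrite -[- p]sub0r ztransB ztrans0 sub0r. Qed.
Lemma ztransC (b c : C) j : ztrans b j (c%:MP : K) = c%:MP.
Proof. by rewrite /ztrans comp_mpolyC. Qed.
Lemma ztrans_down_X j k : ztrans (-1 : C) j 'X_k = 'X_k - (k == j)%:R :> K.
Proof.
rewrite /ztrans comp_mpolyXU -tnth_nth tnth_mktuple; congr (_ + _).
by rewrite mulNrn mpolyCN -mpolyC_nat.
Qed.

Lemma gshift_is_zmod_morphism j : zmod_morphism (@gshift C n j).
Proof. by move=> f g; apply: gseriesP => l /=; rewrite ztransB. Qed.

Lemma gshift_mono j c m :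
  gshift j (gmono c m) = gmono (ztrans (-1) j c) (ztrans (-1) j m).
Proof.
apply: gseriesP => l /=; have [->|lm] := eqVneq l (ztrans (-1) j m).
  by rewrite ztransKV eqxx.
by case: (ztrans 1 j l =P m) lm => [<-|_ _]; rewrite ?ztransK ?eqxx // ztrans0.
Qed.

Lemma gshift_is_monoid_morphism j : monoid_morphism (@gshift C n j).
Proof.
split=> [|f g]; first by rewrite [LHS]gshift_mono ztrans1 ztrans0.
apply: gseriesP => l /=; rewrite /gconv.
have [A HA] := gmul_finite f g (ztrans 1 j l).
transitivity (\sum_(m \in [set: K])
    ztrans (-1) j (f m) * ztrans (-1) j (g (ztrans 1 j l - m))).
  rewrite !(fsum_seq (X := A)) // => [|m].
    rewrite (big_morph (ztrans (-1) j) (id1 := 0) (op1 := +%R)) ?ztrans0 //.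
      by apply: eq_bigr => m _; rewrite ztransM.
    exact: ztransD.
  by rewrite -ztransM => H; apply: HA; apply: contraNneq H => ->; rewrite ztrans0.
have bij : bijective (@ztrans C n 1 j).
  by exists (ztrans (-1) j) => m; rewrite (ztransK, ztransKV).
rewrite [LHS](reindex_fsbigT (ztrans 1 j) _ bij).
by apply: eq_fsbigr => m _; rewrite -ztransB.
Qed.

HB.instance Definition _ j :=
  GRing.isZmodMorphism.Build S S (@gshift C n j) (gshift_is_zmod_morphism j).
HB.instance Definition _ j :=
  GRing.isMonoidMorphism.Build S S (@gshift C n j) (gshift_is_monoid_morphism j).

Implicit Types (a b : nat -> K).

Lemma gcoef_powser a k : gpowser a (- k%:R) = a k.
Proof.
rewrite /= (_ : [set i : nat | _]%classic = [set k]%classic) ?fsbig_set1 //.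
apply/seteqP; split => i /=; last by move=> ->.
by move=> /oppr_inj /mpoly_natr_inj.
Qed.

Lemma gcoef_powser_neq0 a l : gpowser a l != 0 -> exists k : nat, l = - k%:R.
Proof.
move=> H; apply: contrapT => Hn; case/eqP: H; apply: fsbig1 => k /= lk.
by case: Hn; exists k.
Qed.

Lemma gpowserP f a : (forall k, f (- k%:R) = a k) ->
  (forall l, f l != 0 -> exists k : nat, l = - k%:R) -> f = gpowser a.
Proof.
move=> Hf Hl; apply: gseriesP => l.
have [[k ->]|Hn] := pselect (exists k : nat, l = - k%:R).
  by rewrite Hf gcoef_powser.
have -> : f l = 0 by apply/eqP/negPn/negP => /Hl.
by symmetry; apply/eqP/negPn/negP => /gcoef_powser_neq0.
Qed.

Lemma gpowser_sum I (r : seq I) (F : I -> nat -> K) :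
  \sum_(i <- r) gpowser (F i) = gpowser (fun k => \sum_(i <- r) F i k).
Proof.
apply: gpowserP => [k|l]; rewrite gcoef_sum.
  by apply: eq_bigr => i _; rewrite gcoef_powser.
move=> H; apply: contrapT => Hn; case/eqP: H; apply: big1 => i _.
by apply/eqP/negPn/negP => /gcoef_powser_neq0.
Qed.

Lemma gpowserM a b :
  gpowser a * gpowser b = gpowser (fun k => \sum_(i < k.+1) a i * b (k - i)%N).
Proof.
apply: gpowserP => [k|l]; rewrite gcoefM /gconv.
  rewrite (fsum_seq (X := [seq - i%:R | i <- iota 0 k.+1])).
    rewrite undup_id ?map_inj_uniq ?iota_uniq //; last first.
      by move=> i j /oppr_inj /mpoly_natr_inj.
    rewrite big_map -[iota 0 k.+1]/(index_iota 0 k.+1) big_mkord.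
    apply: eq_bigr => i _; have ik : (i <= k)%N by rewrite -ltnS.
    have -> : - k%:R - - i%:R = - (k - i)%:R :> K by rewrite natrB //; ring.
    by rewrite !gcoef_powser.
  move=> m; rewrite mulf_eq0 negb_or => /andP[/gcoef_powser_neq0[i ->]].
  move=> /gcoef_powser_neq0[j E].
  have -> : k = (i + j)%N.
    by apply: (@mpoly_natr_inj C n); rewrite natrD -[j%:R]opprK -E; ring.
  by apply/mapP; exists i => //; rewrite mem_iota /= add0n ltnS leq_addr.
move=> /fsum_neq0[m]; rewrite mulf_eq0 negb_or => /andP[].
move=> /gcoef_powser_neq0[i Ei] /gcoef_powser_neq0[j Ej].
by exists (i + j)%N; rewrite -[l](subrK m) Ej Ei natrD opprD addrC.
Qed.

Lemma gconst_mul_powser c a : gconst c * gpowser a = gpowser (fun k => c * a k).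
Proof.
apply: gpowserP => [k|l]; rewrite gcoef_constM ?gcoef_powser //.
by rewrite mulf_eq0 negb_or => /andP[_ /gcoef_powser_neq0].
Qed.

Lemma gpow_mul_powser a :
  gpow (-1) * gpowser a = gpowser (fun k => if k is k'.+1 then a k' else 0).
Proof.
apply: gpowserP => [k|l]; rewrite gcoef_powM opprK.
  case: k => [|k]; last by rewrite -natr1 opprD addrNK gcoef_powser.
  apply/eqP/negPn/negP => /gcoef_powser_neq0[k E].
  have := @mpoly_natr_inj C n k.+1 0; rewrite -natr1 -[k%:R]opprK -E.
  by rewrite mulr0n oppr0 add0r addNr => /(_ erefl).
move=> /gcoef_powser_neq0[k E]; exists k.+1.
by rewrite -natr1 opprD -E addrK.
Qed.

Lemma gderiv_powser a :
  gderiv (gpowser a) = gpow (-1) * gpowser (fun k => - k%:R * a k).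
Proof.
apply: gseriesP => l; rewrite gcoef_powM opprK.
transitivity ((l + 1) * gpowser a (l + 1)); first by [].
have [[k ->]|Hn] := pselect (exists k : nat, l + 1 = - k%:R).
  by rewrite !gcoef_powser.
have z b : gpowser b (l + 1) = 0.
  by apply/eqP/negPn/negP => /gcoef_powser_neq0.
by rewrite !z mulr0.
Qed.

Lemma gshift_powser j a :
  gshift j (gpowser a) = gpowser (fun k => ztrans (-1) j (a k)).
Proof.
have gE l : gshift j (gpowser a) l = ztrans (-1) j (gpowser a (ztrans 1 j l)) by [].
have zN k : ztrans 1 j (- k%:R) = - k%:R :> K by rewrite ztransN ztrans_nat.
apply: gpowserP => [k|l]; rewrite gE; first by rewrite zN gcoef_powser.
move=> H; have /gcoef_powser_neq0[k E] : gpowser a (ztrans 1 j l) != 0.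
  by apply: contraNneq H => ->; rewrite ztrans0.
by exists k; apply: (can_inj (ztransK 1 j)); rewrite E zN.
Qed.

Local Notation kmx A := (map_mx (@gconst C n) A).
Implicit Types (A : 'M[K]_n) (F G : nat -> 'M[K]_n).

Lemma mpowser_inj F G : mpowser F = mpowser G -> forall k, F k = G k.
Proof.
move=> E k; apply/matrixP => i j; have /matrixP/(_ i j) := E; rewrite !mxE.
by move=> /(congr1 (fun f : S => f (- k%:R))); rewrite !gcoef_powser.
Qed.

Lemma eq_mpowser F G : F =1 G -> mpowser F = mpowser G.
Proof. by move=> /funext ->. Qed.

Lemma mpowserM F G :
  mpowser F *m mpowser G = mpowser (fun k => \sum_(i < k.+1) F i *m G (k - i)%N).
Proof.
apply/matrixP => i j; rewrite !mxE.
under eq_bigr => l _ do rewrite !mxE gpowserM.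
rewrite gpowser_sum; congr gpowser; apply/funext => k.
rewrite exchange_big summxE /=; apply: eq_bigr => l _.
by rewrite mxE.
Qed.

Lemma mpowserD F G : mpowser F + mpowser G = mpowser (fun k => F k + G k).
Proof.
apply/matrixP => i j; rewrite !mxE.
have := gpowser_sum [:: (fun k => F k i j); (fun k => G k i j)] id.
rewrite !big_cons big_nil addr0 => ->; congr gpowser; apply/funext => k.
by rewrite !big_cons big_nil addr0 mxE.
Qed.

Lemma kmxE A : kmx A = mpowser (fun k => if k == 0%N then A else 0).
Proof.
apply/matrixP => i j; rewrite !mxE; apply: gpowserP => [k|l] /=.
  by rewrite oppr_eq0 -(inj_eq (@mpoly_natr_inj C n) k 0%N); case: eqP; rewrite ?mxE.
by case: (l =P 0) => [-> _|]; rewrite ?eqxx //; exists 0%N; rewrite oppr0.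
Qed.

Lemma kmx_mpowser A F : kmx A *m mpowser F = mpowser (fun k => A *m F k).
Proof.
apply/matrixP => i j; rewrite !mxE.
under eq_bigr => l _ do rewrite !mxE gconst_mul_powser.
by rewrite gpowser_sum; congr gpowser; apply/funext => k; rewrite mxE.
Qed.

Lemma mpowser_kmx A F : mpowser F *m kmx A = mpowser (fun k => F k *m A).
Proof.
apply/matrixP => i j; rewrite !mxE.
under eq_bigr => l _ do rewrite !mxE mulrC gconst_mul_powser.
rewrite gpowser_sum; congr gpowser; apply/funext => k; rewrite mxE.
by apply: eq_bigr => l _; rewrite mulrC.
Qed.

Lemma gconst_mpowser c F : gconst c *: mpowser F = mpowser (fun k => c *: F k).
Proof.
apply/matrixP => i j; rewrite !mxE gconst_mul_powser.
by congr gpowser; apply/funext => k; rewrite mxE.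
Qed.

Lemma gpow_mpowser F : gpow (-1) *: mpowser F
  = mpowser (fun k => if k is k'.+1 then F k' else 0).
Proof.
apply/matrixP => i j; rewrite !mxE gpow_mul_powser.
by congr gpowser; apply/funext => -[|k]; rewrite ?mxE.
Qed.

Lemma gderiv_mpowser F : map_mx (@gderiv C n) (mpowser F)
  = gpow (-1) *: mpowser (fun k => - k%:R *: F k).
Proof.
apply/matrixP => i j; rewrite !mxE gderiv_powser.
by congr (_ * gpowser _); apply/funext => k; rewrite mxE.
Qed.

Lemma gshift_mpowser j F : map_mx (gshift j) (mpowser F)
  = mpowser (fun k => map_mx (ztrans (-1) j) (F k)).
Proof.
apply/matrixP => i l; rewrite !mxE gshift_powser.
by congr gpowser; apply/funext => k; rewrite mxE.
Qed.

Lemma gderiv_mulmx (A B : 'M[S]_n) : map_mx (@gderiv C n) (A *m B)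
  = map_mx (@gderiv C n) A *m B + A *m map_mx (@gderiv C n) B.
Proof.
apply/matrixP => i j; rewrite !mxE raddf_sum -big_split; apply: eq_bigr => k _.
by rewrite /= gderivM !mxE.
Qed.

End GSeriesCalculus.

(** The stage [s k] of the construction is correct on the first k terms, which
    is all that [Phi k] looks at. *)
Lemma strong_rec (T : Type) (x0 : T) (Phi : nat -> (nat -> T) -> T) :
  (forall k F G, (forall i, (i < k)%N -> F i = G i) -> Phi k F = Phi k G) ->
  exists F, forall k, F k = Phi k F.
Proof.
move=> Phi_ext.
pose fix s k : nat -> T := if k is k'.+1
  then (fun i => if i == k' then Phi k' (s k') else s k' i) else fun=> x0.
pose F k := s k.+1 k.
have sF k i : (i < k)%N -> s k i = F i.
  elim: k => // k IH; rewrite ltnS leq_eqVlt => /predU1P[->//|ik] /=.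
  by rewrite (ltn_eqF ik) IH.
exists F => k; rewrite {1}/F /= eqxx; apply: Phi_ext => i; exact: sF.
Qed.

(** A left inverse is computed coefficient by coefficient; for square matrices
    over a commutative ring that is enough. *)
Lemma mpowser_unit (C : numFieldType) n (F : nat -> 'M[{mpoly C[n]}]_n) :
  F 0%N = 1%:M -> mpowser F \in unitmx.
Proof.
move=> F0.
pose Phi k (L : nat -> 'M[{mpoly C[n]}]_n) :=
  (k == 0%N)%:R%:M - \sum_(i < k) L i *m F (k - i)%N.
have [|L LE] := strong_rec 0 (Phi := Phi).
  move=> k G H GH; congr (_ - _); apply: eq_bigr => i _.
  by rewrite GH.
suff /mulmx1_unit[] : mpowser L *m mpowser F = 1%:M by [].
rewrite mpowserM -(map_mx1 (@gconst C n)) kmxE; apply: eq_mpowser => k.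
rewrite big_ord_recr /= subnn F0 mulmx1 (LE k) addrC subrK.
by case: eqP => _ //; apply/matrixP => i j; rewrite !mxE mul0rn.
Qed.

(** * Formal gauge transformations of an irregular singularity *)

(** The equation is the coefficient of s^(-k-1) in F' = A F - F diag(u) - (lam
    / s) F, where A = diag(u) + A_1 / s + A_2 / s^2 + .... Its off-diagonal
    part determines the off-diagonal part [O] of F_(k+1), since the
    differences of the u_a are invertible. Its diagonal part does not involve
    F_(k+1), but the next coefficient does on the diagonal, through (A_1
    F_(k+1))_aa - (lam - (k+1)) (F_(k+1))_aa; as (A_1)_aa = lam, this fixes
    the diagonal part [d] of F_(k+1) once k + 1 is invertible. For the very
    first coefficient the diagonal condition is (A_1)_aa = lam itself. *)
Lemma formal_gauge (K : comUnitRingType) n (u : 'rV[K]_n) (lam : K)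
    (A : nat -> 'M[K]_n) :
  (forall a b, a != b -> u 0 b - u 0 a \is a GRing.unit) ->
  (forall k, k.+1%:R \is a @GRing.unit K) ->
  (forall a, A 1%N a a = lam) ->
  exists F : nat -> 'M[K]_n, F 0%N = 1%:M /\
    forall k, F k.+1 *m diag_mx u - diag_mx u *m F k.+1 + (lam - k%:R) *: F k
      = \sum_(i < k.+1) A (k.+1 - i)%N *m F i.
Proof.
move=> u_unit nat_unit A1.
pose r k (F : nat -> 'M[K]_n) :=
  \sum_(i < k.+1) A (k.+1 - i)%N *m F i - (lam - k%:R) *: F k.
pose O k F : 'M[K]_n := \matrix_(a, b)
  if a == b then 0 else (r k F) a b / (u 0 b - u 0 a).
pose d k F : 'rV[K]_n := \row_a (- k.+1%:R^-1
  * (A 1%N *m O k F + \sum_(i < k.+1) A (k.+2 - i)%N *m F i) a a).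
pose Phi k F := if k is k'.+1 then O k' F + diag_mx (d k' F) else 1%:M.
have [|F FE] := strong_rec 0 (Phi := Phi).
  case=> // k F G FG.
  have sumE m : \sum_(i < k.+1) A (m - i)%N *m F i
      = \sum_(i < k.+1) A (m - i)%N *m G i.
    by apply: eq_bigr => i _; rewrite FG.
  have OE : O k F = O k G.
    by apply/matrixP => a b; rewrite /O /r !mxE sumE FG.
  by rewrite /= /d OE sumE.
exists F; split; first by rewrite FE.
move=> k; rewrite -[RHS](subrK ((lam - k%:R) *: F k)) -[X in _ = X + _]/(r k F).
congr (_ + _).
have Oaa m a : O m F a a = 0 by rewrite mxE eqxx.
have FS m : F m.+1 = O m F + diag_mx (d m F) := FE m.+1.
apply/matrixP => a b; rewrite mul_mx_diag mul_diag_mx mxE [X in X + _]mxE.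
rewrite [X in _ + X]mxE [X in _ - X]mxE [u 0 a * _]mulrC -mulrBr.
have [<-{b}|ab] := eqVneq a b; last first.
  by rewrite FS mxE [X in _ + X]mxE (negPf ab) addr0 mxE (negPf ab) divrK // u_unit.
(* On the diagonal the commutator vanishes, so the k-th residual must vanish
   there. *)
rewrite subrr mulr0; case: k => [|k].
  by rewrite /r big_ord1 (FE 0%N) /= mulmx1 subr0 !mxE A1 eqxx mulr1 subrr.
rewrite /r big_ord_recr /= subSnn.
set T := \sum_(i < _) _; set c := lam - _.
have FSaa : F k.+1 a a = d k F 0 a by rewrite FS mxE Oaa add0r mxE eqxx mulr1n.
have -> : (T + A 1%N *m F k.+1 - c *: F k.+1) a a
    = (A 1%N *m O k F + T) a a + k.+1%:R * d k F 0 a.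
  rewrite mxE [X in _ + X]mxE [X in X + _]mxE [X in - X]mxE FSaa.
  rewrite FS mulmxDr mul_mx_diag [(_ + \matrix_(_, _) _) _ _]mxE.
  rewrite [(\matrix_(_, _) _) _ _]mxE A1 [RHS]addrC [(_ + T) _ _]mxE /c; ring.
by rewrite [d k F 0 a]mxE mulNr mulrN mulVKr // subrr.
Qed.

(** * The Fourier matrix *)

Section Fourier.
Variable R : realType.
Local Open Scope complex_scope.
Implicit Types t : R.

Definition cis t : R[i] := cos t +i* sin t.

Lemma cisD t t' : cis (t + t') = cis t * cis t'.
Proof. by rewrite /cis cosD sinD; simpc; congr (_ +i* _); ring. Qed.

Lemma cis0 : cis 0 = 1. Proof. by rewrite /cis cos0 sin0. Qed.

Lemma cisX t k : cis t ^+ k = cis (k%:R * t).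
Proof.
elim: k => [|k IH]; first by rewrite mul0r cis0.
by rewrite exprS IH -cisD -natr1 mulrDl mul1r addrC.
Qed.

Lemma cis2pi : cis (2 * pi) = 1.
Proof. by rewrite /cis mulr_natl cos2pi sin2pi. Qed.

(** If cos t = 1, then sin (t/2) = 0 by the duplication formula, while 0 < t/2
    < pi. *)
Lemma cis_neq1 t : 0 < t < 2 * pi -> cis t != 1.
Proof.
move=> /andP[t0 t2]; apply/eqP => /(congr1 (@complex.Re R)) /= ct.
have : 0 < sin (t / 2) by apply: sin_gt0_pi; apply/andP; split; lra.
suff -> : sin (t / 2) = 0 by rewrite ltxx.
apply/eqP; rewrite -sqrf_eq0; apply/eqP.
have := cosD (t / 2) (t / 2); rewrite -splitr ct -!expr2 => h.
have := cos2Dsin2 (t / 2); lra.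
Qed.

Lemma cisN t : cis (- t) = (cis t)^-1.
Proof.
have E : cis t * cis (- t) = 1 by rewrite -cisD subrr cis0.
have t0 : cis t != 0.
  by apply: contraPneq E => ->; rewrite mul0r => /esym/eqP; rewrite oner_eq0.
by apply: (mulfI t0); rewrite divff.
Qed.

Lemma cis_neq0 t : cis t != 0.
Proof.
by rewrite -invr_eq0 -cisN; apply/eqP => E; have := cisD t (- t);
  rewrite subrr cis0 E mulr0 => /eqP; rewrite oner_eq0.
Qed.

Lemma cexp_im t : cexp (t%:C * 'i) = cis t.
Proof. by rewrite /cexp /cis; simpc; rewrite expR0 !mul1r. Qed.

Variable n : nat.
Hypothesis n_gt0 : (0 < n)%N.

Lemma zetaE : zeta R n = cis (2 * pi / n%:R).
Proof.
rewrite -cexp_im /zeta; congr cexp.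
by rewrite !rmorphM fmorphV !rmorph_nat mulrAC.
Qed.

Lemma calE_cis (a k : 'I_n) : calE R n a k
  = ((Num.sqrt n%:R : R)^-1)%:C * cis (a%:R * (2 * k%:R + 1) * pi / n%:R).
Proof.
rewrite mxE -cexp_im; congr (_ * cexp _).
have -> : 2 * k%:R + 1 = (2 * k)%N.+1%:R :> R by rewrite -[in RHS]natr1 natrM.
rewrite mulrAC !rmorphM fmorphV !rmorph_nat.
rewrite -(@natr1 _ (2 * k)%N) -(@natr1 _ k) natrM; congr (_ * _ * _ * _ * _).
by ring.
Qed.

Lemma zeta_neq0 : zeta R n != 0.
Proof. by rewrite zetaE cis_neq0. Qed.

Lemma zeta_prim : n.-primitive_root (zeta R n).
Proof.
have n0 : n%:R != 0 :> R by rewrite pnatr_eq0 -lt0n.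
have zX k : zeta R n ^+ k = cis (2 * pi * (k%:R / n%:R)).
  by rewrite zetaE cisX; congr cis; ring.
apply/andP; split=> //; apply/forallP => -[k kn] /=; rewrite unity_rootE zX.
have [->|ne] := eqVneq k.+1 n; first by rewrite divff // mulr1 cis2pi eqxx.
rewrite (negPf (cis_neq1 _)) //.
have k1 : (k.+1 < n)%N by rewrite ltn_neqAle ne.
rewrite mulr_gt0 ?divr_gt0 ?mulr_gt0 ?pi_gt0 ?ltr0n //=.
by rewrite gtr_pMr ?mulr_gt0 ?pi_gt0 ?ltr0n // ltr_pdivrMr ?ltr0n // mul1r ltr_nat.
Qed.

Lemma zeta_inj (a b : 'I_n) : zeta R n ^+ a = zeta R n ^+ b -> a = b.
Proof.
move=> /eqP; rewrite (eq_prim_root_expr zeta_prim) !modn_small // => /eqP.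
exact: val_inj.
Qed.

(** The conjugate transpose of [calE], written out. *)
Definition calEV : 'M[R[i]]_n := \matrix_(k, a)
  (((Num.sqrt n%:R : R)^-1)%:C * cis (- (a%:R * (2 * k%:R + 1) * pi / n%:R))).

Lemma calE_mul_calEV (a b k : 'I_n) : calE R n a k * calEV k b
  = n%:R^-1 * cis ((a%:R - b%:R) * pi / n%:R) * (zeta R n ^+ a / zeta R n ^+ b) ^+ k.
Proof.
rewrite calE_cis mxE mulrACA -rmorphM -invfM -expr2 sqr_sqrtr ?ler0n //.
rewrite fmorphV rmorph_nat -cisD -[RHS]mulrA; congr (_ * _).
rewrite zetaE !cisX -cisN -cisD cisX -cisD; congr cis; ring.
Qed.

Lemma calE_mulV : calE R n *m calEV = 1%:M.
Proof.
have n0 : n%:R != 0 :> R[i] by rewrite pnatr_eq0 -lt0n.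
apply/matrixP => a b; rewrite !mxE.
under eq_bigr => k _ do rewrite calE_mul_calEV.
rewrite -mulr_sumr; have [->|ab] := eqVneq a b.
  rewrite subrr !mul0r cis0 mulr1.
  rewrite (eq_bigr (fun=> 1)) => [|k _]; last first.
    by rewrite divff ?expr1n // expf_neq0 // zeta_neq0.
  by rewrite sumr_const card_ord mulVf.
set w := zeta R n ^+ a / zeta R n ^+ b; suff -> : \sum_(k < n) w ^+ k = 0 by rewrite mulr0.
have w1 : w - 1 != 0.
  rewrite subr_eq0; apply: contra_neq ab => w1; apply: zeta_inj.
  rewrite -[LHS](divfK (expf_neq0 b zeta_neq0)) -/w w1 mul1r //.
apply: (mulfI w1); rewrite mulr0 -subrX1 expr_div_n -!exprM ![(_ * n)%N]mulnC !exprM.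
by rewrite (prim_expr_order zeta_prim) !expr1n divr1 subrr.
Qed.

Lemma calE_unit : calE R n \in unitmx.
Proof. by case: (mulmx1_unit calE_mulV). Qed.

Lemma invmx_calE : invmx (calE R n) = calEV.
Proof. by rewrite -[LHS]mulmx1 -calE_mulV mulmxA mulVmx ?calE_unit // mul1mx. Qed.

(** All the entries of the unitary matrix [calE] have modulus n^(-1/2). Hence
    conjugating a diagonal matrix by [calE] yields a matrix with constant
    diagonal. *)
Lemma calE_mul_invmx (a k : 'I_n) : calE R n a k * invmx (calE R n) k a = n%:R^-1.
Proof.
rewrite invmx_calE calE_mul_calEV subrr !mul0r cis0 mulr1 divff ?expr1n ?mulr1 //.
by rewrite expf_neq0 // zeta_neq0.
Qed.

Definition cyclic_mx (T : pzSemiRingType) : 'M[T]_n :=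
  \matrix_(k, j) (k == (j.+1 %% n)%N :> nat)%:R.

(** Moving to the next column multiplies row a by zeta^a, including from the
    last column to the first because zeta^n = 1. *)
Lemma calE_cyclic : calE R n *m cyclic_mx R[i]
  = diag_mx (\row_a zeta R n ^+ a) *m calE R n.
Proof.
have n0 : n%:R != 0 :> R by rewrite pnatr_eq0 -lt0n.
rewrite mul_diag_mx; apply/matrixP => a j; rewrite [LHS]mxE [RHS]mxE.
pose j' := Ordinal (ltn_pmod j.+1 n_gt0).
rewrite (bigD1 j') //= big1 ?addr0 => [|k kj]; last first.
  by rewrite [cyclic_mx _ _ _]mxE (negPf (kj : k != _ :> nat)) mulr0.
rewrite [cyclic_mx _ _ _]mxE eqxx mulr1 [(\row__ _) _ _]mxE !calE_cis mulrCA.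
congr (_ * _); rewrite zetaE cisX -cisD /=.
have [jn|jn] := ltnP j.+1 n.
  by rewrite modn_small // -natr1; congr cis; ring.
have -> : j.+1 = n by apply/eqP; rewrite eqn_leq jn andbT.
have -> : j%:R = n%:R - 1 :> R.
  by apply: (canRL (addrK 1)); rewrite natr1; congr _%:R; apply/eqP; rewrite eqn_leq jn andbT.
rewrite modnn mulr0 add0r mulr1.
have -> : a%:R * (2 * pi / n%:R) + a%:R * (2 * (n%:R - 1) + 1) * pi / n%:R
    = a%:R * (2 * pi) + a%:R * pi / n%:R :> R by field.
by rewrite cisD -cisX cis2pi expr1n mul1r.
Qed.

End Fourier.

(** * Ratios of formal solutions *)

Section Gauge.
Variables (C : numFieldType) (n : nat).
Local Notation K := {mpoly C[n]}.
Local Notation S := (gseries C n).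
Local Notation kmx A := (map_mx (@gconst C n) A).
Local Notation D := (map_mx (@gderiv C n)).
Implicit Types (u : 'rV[C]_n) (B G Y : 'M[S]_n).

Lemma mconstE (A : 'M[C]_n) : mconst A = kmx (map_mx (@mpolyC n C) A).
Proof. by apply/matrixP => i j; rewrite !mxE. Qed.

Lemma gshift_mconst j (A : 'M[C]_n) : map_mx (gshift j) (mconst A) = mconst A.
Proof.
apply/matrixP => a b; rewrite [LHS]mxE ![mconst A a b]mxE.
by rewrite -[LHS]/(gshift j (gmono _ 0)) gshift_mono ztrans0 ztransC.
Qed.

Lemma gderiv_kmx (A : 'M[K]_n) : D (kmx A) = 0.
Proof. by apply/matrixP => i j; rewrite !mxE gderiv_const. Qed.

(** The quotient T = G^(-1) Y satisfies T' = [U, T], that is T_ab' = (u_a -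
    u_b) T_ab. The off-diagonal entries vanish by [gderiv_eigen], and the
    diagonal ones are constant. *)
Lemma gauge_ratio u B G Y : injective (u 0) -> G \in unitmx ->
  D G = B *m G - G *m mconst (diag_mx u) ->
  D Y = B *m Y - Y *m mconst (diag_mx u) ->
  exists A : 'M[K]_n, Y = G *m kmx A.
Proof.
set U := mconst _ => u_inj Gu DG DY.
have [T GT] : exists T, G *m T = Y by exists (invmx G *m Y); rewrite mulKVmx.
have DT : D T = U *m T - T *m U.
  have : G *m D T = G *m (U *m T - T *m U).
    have := gderiv_mulmx G T; rewrite GT DG DY mulmxBl -!mulmxA GT.
    rewrite -addrA => /addrI E; apply: (addrI (- (G *m (U *m T)))).
    by rewrite -E mulmxBr (mulmxA G T) GT addrA addNr add0r.
  by move=> /(congr1 (mulmx (invmx G))); rewrite !mulKmx.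
exists (\matrix_(a, b) T a b 0); rewrite -GT; congr (_ *m _).
have UE : U = diag_mx (\row_a gconst (u 0 a)%:MP).
  apply/matrixP => a b; rewrite !mxE; case: (a == b); rewrite ?mulr1n //.
  by rewrite !mulr0n !rmorph0.
apply/matrixP => a b; rewrite !mxE.
have DTab : gderiv (T a b) = gconst (u 0 a - u 0 b)%:MP * T a b.
  have /matrixP/(_ a b) := DT; rewrite UE mul_diag_mx mul_mx_diag !mxE => ->.
  by rewrite mpolyCB rmorphB /=; ring.
have [ab|ab] := eqVneq a b.
  by apply: gderiv_eq0; rewrite DTab ab subrr mpolyC0 rmorph0 mul0r.
have -> : T a b = 0.
  by apply: (gderiv_eigen _ DTab); rewrite subr_eq0; apply: contra_neq ab => /u_inj.
by rewrite -[LHS](rmorph0 (@gconst C n)).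
Qed.

Lemma formal_gauge_ode (A F : nat -> 'M[K]_n) u (lam : K) :
  A 0%N = map_mx (@mpolyC n C) (diag_mx u) -> F 0%N = 1%:M ->
  (forall k, F k.+1 *m A 0%N - A 0%N *m F k.+1 + (lam - k%:R) *: F k
      = \sum_(i < k.+1) A (k.+1 - i)%N *m F i) ->
  D (mpowser F) = mpowser A *m mpowser F - (gconst lam * gpow (-1)) *: mpowser F
    - mpowser F *m mconst (diag_mx u).
Proof.
move=> A0 F0 FE; rewrite mconstE -A0; apply/eqP; rewrite eq_sym subr_eq eq_sym.
rewrite -subr_eq opprK; apply/eqP.
rewrite gderiv_mpowser -scalerA gpow_mpowser mpowser_kmx mpowserM.
rewrite gpow_mpowser gconst_mpowser !mpowserD; apply: eq_mpowser => -[|k].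
  by rewrite big_ord1 subnn F0 scaler0 addr0 add0r mulmx1 mul1mx.
(* The product of the series pairs A_i with F_(k+1-i), the recursion A_(k+1-i)
   with F_i; the extra term is A_0 F_(k+1). *)
rewrite (reindex_inj rev_ord_inj) /= big_ord_recr /= subnn.
under eq_bigr => i _ do rewrite subSS (subKn (ltnW (ltn_ord i))).
rewrite -FE.
move: (F k.+1 *m A 0%N) (A 0%N *m F k.+1) (F k) => X Y Z.
by apply/matrixP => a b; rewrite !mxE; ring.
Qed.
End Gauge.

(** * The joint system near s = infinity *)

Lemma mesym_meval (S : comNzRingType) n k (v : 'I_n -> S) :
  (mesym n S k).@[v] = \sum_(h : {set 'I_n} | #|h| == k) \prod_(i in h) v i.
Proof.
rewrite /mesym rmorph_sum; apply: eq_bigr => h _; rewrite rmorph_prod.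
by apply: eq_bigr => i _; rewrite /= mevalXU.
Qed.

Lemma rmorph_mesym (S T : comNzRingType) (phi : {rmorphism S -> T}) n k
  (v : 'I_n -> S) : phi (mesym n S k).@[v] = (mesym n T k).@[phi \o v].
Proof.
rewrite !mesym_meval rmorph_sum; apply: eq_bigr => h _.
by rewrite rmorph_prod.
Qed.

Lemma map_qA (S T : comUnitRingType) (phi : {rmorphism S -> T}) n q
  (z : 'I_n -> S) : map_mx phi (qA q z) = qA (phi q) (phi \o z).
Proof.
apply/matrixP => k j; rewrite !mxE; case: ifP => _; first by rewrite rmorph_nat.
rewrite rmorphD rmorphM rmorph_nat rmorph_sum; congr (_ + _).
by apply: eq_bigr => i _; rewrite !rmorphM rmorphXn rmorphN1 rmorph_mesym rmorph_nat.
Qed.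

Lemma natr_pred (T : pzRingType) m : (0 < m)%N -> m.-1%:R = m%:R - 1 :> T.
Proof. by case: m => // m _; rewrite -natr1 addrK. Qed.

Section QuantumAtInfinity.
Variables (C : numFieldType) (n : nat).
Local Notation K := {mpoly C[n]}.
Local Notation S := (gseries C n).
Local Notation kmx A := (map_mx (@gconst C n) A).
Local Notation D := (map_mx (@gderiv C n)).
Local Notation q := (gs ^+ n : S).
Local Notation z := (@zser C n).
Local Notation M := (qA q z).

(** The coefficient of s^(-m) in s^(-1) H^(-1) [qA] H, where q = s^n; it
    vanishes for m > n. The powers of s in H = diag(s^(-j)) balance the
    entries of the companion matrix: the subdiagonal and the corner q become
    s, and the coefficient of degree n - m in the last column, which is a
    multiple of the m-th elementary symmetric polynomial, becomes a multiple
    of s^(1-m). *)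
Definition qA_inf (m : nat) : 'M[K]_n := \matrix_(k, j)
  (((m == 0%N) && (k == (j.+1 %% n)%N :> nat))%:R
  + ((m == n - k)%N && (j.+1 == n))%:R * ((-1) ^+ m.-1 * mesym n C m)).

Lemma gconst_mesym m : (mesym n S m).@[z] = gconst (mesym n C m).
Proof.
rewrite mesym_meval /mesym rmorph_sum; apply: eq_bigr => h _.
by rewrite rmorph_prod.
Qed.

Lemma gpowser_mono (c : K) (p : nat) :
  gpowser (fun k => if k == p then c else 0) = gmono c (- p%:R).
Proof.
symmetry; apply: gpowserP => [k|l] /=.
  by rewrite eqr_opp (inj_eq (@mpoly_natr_inj C n)).
by case: (l =P - p%:R) => [-> _|]; [exists p | rewrite eqxx].
Qed.

Lemma mpowser_qA_inf (k j : 'I_n) : mpowser qA_inf k j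
  = (k == (j.+1 %% n)%N :> nat)%:R
    + (j.+1 == n)%:R * gpow (- (n - k)%:R) * - (prodXz z)`_k.
Proof.
have kn : (n - k <= n)%N by rewrite leq_subr.
have k0 : (0 < n - k)%N by rewrite subn_gt0.
have := prodXz_coef z kn; rewrite subKn ?(ltnW (ltn_ord k)) // gconst_mesym => ->.
have -> : - ((-1) ^+ (n - k) * gconst (mesym n C (n - k))) =
   gconst ((-1) ^+ (n - k).-1 * mesym n C (n - k)).
  by rewrite rmorphM rmorphXn rmorphN1 /= -{1}(prednK k0) exprS; ring.
rewrite mxE; set b := k == _ :> nat; set c := _ * mesym _ _ _.
have -> : (fun m => qA_inf m k j) = (fun m =>
    \sum_(f <- [:: fun m => if m == 0%N then b%:R else 0;
                   fun m => if m == (n - k)%N then (j.+1 == n)%:R * c else 0]) f m).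
  apply/funext => m; rewrite !big_cons big_nil addr0 mxE; congr (_ + _).
    by case: (m == 0%N).
  by rewrite /c; case: eqP => [->|]; rewrite ?mul0r.
rewrite -gpowser_sum !big_cons big_nil addr0 !gpowser_mono oppr0.
congr (_ + _); first by rewrite -[LHS]/(gconst b%:R) rmorph_nat.
have -> : (j.+1 == n)%:R = gconst (j.+1 == n)%:R :> S by rewrite rmorph_nat.
by rewrite mulrAC -rmorphM /= gmonoM add0r mulr1.
Qed.

Lemma calH_entry (j : 'I_n) : gs ^- j = gpow (- j%:R) :> S.
Proof. by rewrite gsX gpowV. Qed.

Lemma qA_calH : M *m calH C n = gs *: (calH C n *m mpowser qA_inf).
Proof.
rewrite mul_mx_diag mul_diag_mx; apply/matrixP => k j.
rewrite [LHS]mxE [RHS]mxE [X in _ = gs * X]mxE ![(\row__ _) _ _]mxE.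
rewrite mpowser_qA_inf qAE !calH_entry mulrA -gpowD.
have [jn|jn] := eqVneq j.+1 n; last first.
  have jltn : (j.+1 < n)%N by rewrite ltn_neqAle jn ltn_ord.
  rewrite !mul0r !addr0 modn_small //; case: eqP => [->|]; last by rewrite mul0r mulr0.
  by rewrite mul1r mulr1 -natr1; congr gpow; ring.
rewrite jn modnn (ltn_eqF (ltn_ord k)) add0r !mul1r mulrBl mulrDr.
have jE : j%:R = n%:R - 1 :> K 
  by apply: (canRL (addrK 1)); rewrite natr1; exact: (congr1 (GRing.natmul 1) jn).
have kE : (n - k)%:R = n%:R - k%:R :> K by rewrite natrB // ltnW.
congr (_ + _).
  case: eqP => [->|]; last by rewrite !mulr0 mul0r.
  by rewrite !mulr1 gsX -gpowD jE; congr gpow; rewrite mulr0n; ring.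
rewrite mulrN mulrN mulrA -gpowD.
have -> : 1 + - k%:R + - (n - k)%:R = - j%:R :> K by rewrite jE kE; ring.
by rewrite mulrC.
Qed.

Lemma qA_inf0 : qA_inf 0 = cyclic_mx n K.
Proof.
apply/matrixP => k j; rewrite !mxE /= [(0 == _)%N]eq_sym subn_eq0 leqNgt ltn_ord.
by rewrite mul0r addr0.
Qed.

(** The coefficient of 1/s of the conjugated operator is diagonal, with s_1(z)
    as its only nonzero entry; this is the source of the term s_1(z) in
    Lambda. *)
Lemma qA_inf1 : qA_inf 1 = diag_mx (\row_k ((k.+1 == n)%:R * mesym n C 1)).
Proof.
apply/matrixP => k j; rewrite !mxE /= add0r expr0 mul1r -mulrnAl; congr (_ * _).
have -> : (1 == n - k)%N = (k.+1 == n).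
  by rewrite -(eqn_add2r k) subnK ?add1n // ltnW.
case: (k.+1 =P n) => [E|_]; last by rewrite /= mul0rn.
have -> : (j.+1 == n) = (k == j).
  by rewrite -(inj_eq val_inj) /= -[RHS](inj_eq succn_inj) eq_sym; congr (_ == _).
by case: (k == j).
Qed.

Lemma gderiv_calH : D (calH C n)
  = - (gpow (-1) *: (calH C n *m kmx (diag_mx (\row_j j%:R)))).
Proof.
apply/matrixP => k j; rewrite map_diag_mx mul_mx_diag !mxE.
case: eqP => [<-|_]; last by rewrite !mulr0n mul0r mulr0 oppr0 raddf0.
rewrite !mulr1n calH_entry gderiv_pow rmorphN mulNr.
by rewrite mulrA -gpowD [-1 + _]addrC mulrC.
Qed.

(** The operator is affine in q, and q occurs only in the corner; this
    isolates the part that depends on s. *)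
Lemma qA0 (p : S) : qA p z = kmx (qA 0 (fun i => 'X_i))
  + p *: \matrix_(k, j) ((k == 0%N :> nat) && (j.+1 == n))%:R.
Proof.
rewrite map_qA rmorph0; apply/matrixP => k j; rewrite !mxE.
have [jn|jn] := ltnP j.+1 n.
  by rewrite (ltn_eqF jn) andbF mulr0 addr0.
have -> : j.+1 == n by rewrite eqn_leq jn andbT.
by rewrite andbT mul0r add0r addrC.
Qed.

Lemma gderiv_qA : D M = (n%:R * gs ^+ n.-1)
  *: \matrix_(k, j) ((k == 0%N :> nat) && (j.+1 == n))%:R.
Proof.
rewrite qA0 map_mxD gderiv_kmx add0r; apply/matrixP => k j; rewrite !mxE.
case: (_ && _); last by rewrite !mulr0 raddf0.
rewrite -![true%:R]/(1 : S) !mulr1 !gsX.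
rewrite -[LHS]/(gderiv _) gderiv_pow rmorph_nat natr_pred //.
exact: leq_ltn_trans (ltn_ord k).
Qed.

Lemma gshift_qA i : map_mx (gshift i) M = qA q (zminus i z).
Proof.
rewrite map_qA rmorphXn; congr qA.
  congr (_ ^+ _); rewrite -[LHS]/(gshift i (gmono 1 1)) gshift_mono.
  by rewrite !ztrans1.
apply/funext => k; rewrite -[LHS]/(gshift i (gmono 'X_k 0)) gshift_mono /zminus ztrans0.
rewrite -[LHS]/(gconst _) -(rmorph_nat (@gconst C n)) -rmorphB; congr gconst.
exact: ztrans_down_X.
Qed.

Lemma gderiv_gshift i (f : S) : gderiv (gshift i f) = gshift i (gderiv f).
Proof.
apply: gseriesP => l /=; rewrite ztransM !ztransD !ztrans1 ztransK.
by [].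
Qed.

(** With M the matrix of quantum multiplication by x and M^- its value at
    z^-_i, this reads M' + (M - z_i) (n/s) M^- = (n/s) M (M - z_i), where ' is
    d/ds. It follows from [qA_sub_mul_shift_diff], the corner terms n s^(n-1)
    cancelling. Multiplying by the inverse of M - z_i on both sides turns it
    into the usual compatibility of Ktilde_i with the qDE. *)
Lemma qDE_qKZ_compat i : D M + (M - (z i)%:M) *m ((n%:R * gpow (-1)) *: qA q (zminus i z))
  = ((n%:R * gpow (-1)) *: M) *m (M - (z i)%:M).
Proof.
rewrite -(subrK M (qA q (zminus i z))) scalerDr mulmxDr -!scalemxAr qA_sub_mul_shift_diff.
rewrite gderiv_qA addrA -[RHS]add0r; congr (_ + _).
  apply/matrixP => k j; rewrite !mxE.
  case: (_ && _); rewrite ?mulr0 ?addr0 // -![true%:R]/(1 : S) !mulr1.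
  have n_gt0 : (0 < n)%N by apply: leq_ltn_trans (ltn_ord k).
  by rewrite mulrN -mulrA !gsX -gpowD [-1 + _]addrC natr_pred // subrr.
by rewrite -scalemxAl mulmxBl mulmxBr mul_scalar_mx mul_mx_scalar.
Qed.

End QuantumAtInfinity.

(** * The transformation *)

Lemma sum_ord_natr (T : comPzRingType) m :
  2 * \sum_(k < m) k%:R = m%:R * (m%:R - 1) :> T.
Proof.
elim: m => [|m IH]; first by rewrite big_ord0 mulr0 mul0r.
by rewrite big_ord_recr /= mulrDr IH -(@natr1 _ m); ring.
Qed.

Section Transformation.
Variables (C : numFieldType) (n : nat).
Local Notation K := {mpoly C[n]}.
Local Notation S := (gseries C n).
Local Notation kmx A := (map_mx (@gconst C n) A).
Local Notation cmx A := (map_mx (@mpolyC n C) A).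
Local Notation D := (map_mx (@gderiv C n)).
Local Notation z := (@zser C n).
Local Notation M := (qA (gs ^+ n : S) z).
Local Notation Lam := (Lambda C n).

(* Only the following properties of the Fourier matrix matter: it diagonalizes
   the cyclic permutation matrix, the eigenvalues being distinct powers of
   [w], and E_ak (E^(-1))_ka = 1/n. *)
Variables (E : 'M[C]_n) (w : C).
Local Notation V := (invmx E).
Hypothesis n_gt0 : (0 < n)%N.
Hypothesis w_neq0 : w != 0.
Hypothesis w_inj : forall a b : 'I_n, w ^+ a = w ^+ b -> a = b.
Hypothesis E_unit : E \in unitmx.
Hypothesis E_cyclic : E *m cyclic_mx n C = diag_mx (\row_a w ^+ a) *m E.
Hypothesis E_mul_invmx : forall a k, E a k * V k a = n%:R^-1.

Definition eigU : 'rV[C]_n := \row_a (n%:R * w ^+ a).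

(** Coefficients of the equation satisfied by the unknown E H^(-1) Y. The
    second summand is the contribution of the derivative of H = diag(s^(-j)).
    *)
Definition gaugeA (k : nat) : 'M[K]_n :=
  cmx E *m (n%:R *: qA_inf C n k
            + (if k == 1%N then diag_mx (\row_j j%:R) else 0)) *m cmx V.

Lemma cmx_EV : cmx E *m cmx V = 1%:M.
Proof. by rewrite -map_mxM mulmxV ?map_mx1 // E_unit. Qed.

Lemma cmx_VE : cmx V *m cmx E = 1%:M.
Proof. by rewrite -map_mxM mulVmx ?map_mx1 // E_unit. Qed.

Lemma conj_qA_inf0 :
  cmx E *m qA_inf C n 0 *m cmx V = cmx (diag_mx (\row_a w ^+ a)).
Proof.
have -> : qA_inf C n 0 = cmx (cyclic_mx n C).
  by rewrite qA_inf0; apply/matrixP => k j; rewrite !mxE rmorph_nat.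
by rewrite -!map_mxM E_cyclic -mulmxA mulmxV ?mulmx1 // E_unit.
Qed.

Lemma gaugeA0 : gaugeA 0 = cmx (diag_mx eigU).
Proof.
rewrite /gaugeA addr0 -scalemxAr -scalemxAl conj_qA_inf0.
apply/matrixP => a b; rewrite !mxE.
by rewrite !(rmorphMn (@mpolyC n C)) rmorphM rmorph_nat mulrnAr.
Qed.

(** Each diagonal entry is the mean of the diagonal matrix that is conjugated
    by E, that is (n s_1 + (0 + 1 + ... + (n - 1))) / n. *)
Lemma gaugeA1 a : gaugeA 1 a a = Lam.
Proof.
have n0 : n%:R != 0 :> C by rewrite pnatr_eq0 -lt0n.
rewrite /gaugeA eqxx qA_inf1.
set d := \row_k _; set d' := \row_k _.
have -> : n%:R *: diag_mx d + diag_mx d' = diag_mx (n%:R *: d + d').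
  by rewrite raddfD /= linearZ.
rewrite mul_mx_diag mxE.
transitivity (\sum_(k < n) (n%:R^-1)%:MP * (n%:R *: d + d') 0 k).
  apply: eq_bigr => k _.
  rewrite [X in X * _]mxE [cmx E a k]mxE [cmx V k a]mxE mulrAC -rmorphM /=.
  congr (_%:MP * _).
  exact: E_mul_invmx.
rewrite -mulr_sumr; under eq_bigr => k _ do rewrite !mxE.
rewrite big_split /= -mulr_sumr -mulr_suml.
have -> : \sum_(k < n) (k.+1 == n)%:R = 1 :> K.
  have kn : (n.-1 < n)%N by rewrite prednK.
  rewrite (bigD1 (Ordinal kn)) //= prednK // eqxx big1 ?addr0 // => k.
  rewrite -(inj_eq val_inj) -(inj_eq succn_inj) /= prednK // => /negPf ->.
  by [].
have -> : \sum_(k < n) k%:R = (n%:R * (n%:R - 1) / 2)%:MP :> K.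
  rewrite -sum_ord_natr mulrAC divff ?mul1r; last by rewrite pnatr_eq0.
  by rewrite rmorph_sum; apply: eq_bigr => k _; rewrite rmorph_nat.
rewrite /Lam mul1r mulrDr -(rmorph_nat (@mpolyC n C)) mulrA -!rmorphM /=.
rewrite mulVf // rmorph1 mul1r; congr (_ + _%:MP); field.
by rewrite n0.
Qed.

Lemma eigU_inj : injective (eigU 0).
Proof.
have n0 : n%:R != 0 :> C by rewrite pnatr_eq0 -lt0n.
by move=> a b; rewrite !mxE => /(mulfI n0) /w_inj.
Qed.

Lemma formal_solution_exists : exists F : nat -> 'M[K]_n, F 0%N = 1%:M /\
  D (mpowser F) = mpowser gaugeA *m mpowser F
    - (gconst Lam * gpow (-1)) *: mpowser F
    - mpowser F *m mconst (diag_mx eigU).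
Proof.
have unitC (c : C) : c != 0 -> c%:MP \is a @GRing.unit K.
  by move=> c0; apply: rmorph_unit; rewrite unitfE.
have [a b ab|k||F [F0 FE]] := @formal_gauge K n (cmx eigU) Lam gaugeA.
- rewrite ![(cmx eigU) _ _]mxE -mpolyCB; apply: unitC; rewrite subr_eq0.
  by apply: contra_neq ab => /eigU_inj.
- by rewrite -(rmorph_nat (@mpolyC n C)); apply: unitC; rewrite pnatr_eq0.
- exact: gaugeA1.
exists F; split; first exact: F0.
by apply: (formal_gauge_ode gaugeA0 F0) => k; rewrite -FE gaugeA0 map_diag_mx.
Qed.

Lemma gderiv_scalemx (c : S) (X : 'M[S]_n) :
  D (c *: X) = gderiv c *: X + c *: D X.
Proof. by apply/matrixP => i j; rewrite !mxE /= gderivM. Qed.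

Local Notation Dj := (diag_mx (\row_(j < n) j%:R) : 'M[K]_n).

Lemma mpowser_gaugeA : mpowser gaugeA = mconst E
  *m (n%:R *: mpowser (@qA_inf C n) + gpow (-1) *: kmx Dj) *m mconst V.
Proof.
rewrite -(rmorph_nat (@gconst C n)) kmxE gpow_mpowser gconst_mpowser mpowserD.
rewrite !mconstE kmx_mpowser mpowser_kmx; apply: eq_mpowser => k.
by rewrite /gaugeA; case: k => [|[|k]].
Qed.

Variable F : nat -> 'M[K]_n.
Hypothesis F0 : F 0%N = 1%:M.
Hypothesis DF : D (mpowser F) = mpowser gaugeA *m mpowser F
    - (gconst Lam * gpow (-1)) *: mpowser F
    - mpowser F *m mconst (diag_mx eigU).

Local Notation P := (mpowser F).
Local Notation H := (calH C n).
Definition gaugeG : 'M[S]_n := H *m mconst V *m P *m (gpow Lam)%:M.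
Local Notation U := (mconst (diag_mx eigU)).
Local Notation B := ((n%:R * gpow (-1)) *: M).

Lemma mconst_EV : mconst E *m mconst V = 1%:M.
Proof. by rewrite !mconstE -map_mxM cmx_EV map_mx1. Qed.
Lemma mconst_VE : mconst V *m mconst E = 1%:M.
Proof. by rewrite !mconstE -map_mxM cmx_VE map_mx1. Qed.

Lemma calH_unit : H \in unitmx.
Proof.
suff HV : H *m diag_mx (\row_j gs ^+ j) = 1%:M by exact: (proj1 (mulmx1_unit HV)).
rewrite mul_mx_diag; apply/matrixP => k j; rewrite !mxE.
case: eqP => [->|_]; last by rewrite mul0r.
by rewrite mulr1n mulVr // gsX gpow_unit.
Qed.

Lemma gaugeG_unit : gaugeG \in unitmx.
Proof.
rewrite /gaugeG !unitmx_mul calH_unit mpowser_unit // andbT.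
rewrite (proj2 (mulmx1_unit mconst_EV)) /=.
by rewrite unitmxE det_scalar unitrX // gpow_unit.
Qed.

Lemma gaugeGE : gaugeG = gpow Lam *: (H *m mconst V *m P).
Proof. by rewrite /gaugeG mul_mx_scalar. Qed.

(** This lemma and those below whose names end in _comb are matrix algebra,
    stated for arbitrary matrices to show which relations each step depends
    on. *)
Lemma conj_gauge_comb (X N T Y W W' : 'M[S]_n) (c t r : S) :
  W *m W' = 1%:M -> Y *m X = r *: (X *m N) -> t * r = 1 ->
  X *m W *m (W' *m (c *: N + t *: T) *m W)
  = ((c * t) *: Y) *m (X *m W) + t *: (X *m T *m W).
Proof.
move=> WW' YX tr; rewrite !mulmxA -(mulmxA X) WW' mulmx1 mulmxDr mulmxDl.
congr (_ + _); last by rewrite -scalemxAr -scalemxAl.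
by rewrite -!scalemxAl YX -scalemxAr -!scalemxAl scalerA -mulrA tr mulr1.
Qed.

Lemma calH_mul_gaugeA : H *m mconst V *m mpowser gaugeA
  = B *m (H *m mconst V) + gpow (-1) *: (H *m kmx Dj *m mconst V).
Proof.
rewrite mpowser_gaugeA.
have tr : gpow (-1) * gs = 1 :> S by rewrite -gpowD addNr.
exact: (conj_gauge_comb (kmx Dj) n%:R mconst_VE (qA_calH C n) tr).
Qed.

Lemma gderiv_calH_mconst :
  D (H *m mconst V) = - (gpow (-1) *: (H *m kmx Dj *m mconst V)).
Proof.
rewrite gderiv_mulmx gderiv_calH [mconst V]mconstE gderiv_kmx mulmx0 addr0.
by rewrite mulNmx -scalemxAl.
Qed.

(** Used in [gaugeG_ode]: the derivative of the diagonal prefactor cancels the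
    correction term of [gaugeA]. *)
Lemma gauge_ode_comb (W X A N Q T : 'M[S]_n) (t c : S) :
  X *m A = N *m X + t *: W ->
  - (t *: W) *m Q + X *m (A *m Q - c *: Q - Q *m T)
  = N *m (X *m Q) - c *: (X *m Q) - X *m Q *m T.
Proof.
move=> XA; rewrite !mulmxBr !mulmxA XA mulmxDl -scalemxAr !addrA.
by rewrite mulNmx [- _ + _]addrC subrK.
Qed.

Lemma gaugeG_ode : D gaugeG = B *m gaugeG - gaugeG *m U.
Proof.
have DX : D (H *m mconst V *m P) = B *m (H *m mconst V *m P)
    - (gconst Lam * gpow (-1)) *: (H *m mconst V *m P) - H *m mconst V *m P *m U.
  rewrite gderiv_mulmx DF gderiv_calH_mconst.
  exact: gauge_ode_comb calH_mul_gaugeA.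
rewrite gaugeGE; move: (H *m mconst V *m P) DX => X DX.
rewrite gderiv_scalemx gderiv_pow DX gpowD.
move: (B) (U) => N T.
rewrite -scalemxAr -scalemxAl.
move: (N *m X) (X *m T) => Y Y'.
by apply/matrixP => a b; rewrite !mxE; ring.
Qed.

Definition zetaV : 'M[S]_n := mconst (diag_mx (\row_a w ^- a)).

Variable i : 'I_n.
Local Notation Gm := (map_mx (gshift i) gaugeG).
Local Notation Mm := (qA (gs ^+ n : S) (zminus i z)).

Lemma gshift_gaugeG_ode :
  D Gm = ((n%:R * gpow (-1)) *: Mm) *m Gm - Gm *m U.
Proof.
have -> : D Gm = map_mx (gshift i) (D gaugeG).
  by apply/matrixP => a b; rewrite !mxE /= gderiv_gshift.
have c_shift : (gshift i : {rmorphism S -> S}) (n%:R * gpow (-1)) = n%:R * gpow (-1).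
  rewrite rmorphM rmorph_nat; congr (_ * _).
  rewrite -[LHS]/(gshift i (gmono 1 (-1))) gshift_mono ztrans1.
  by rewrite ztransN ztrans1.
rewrite gaugeG_ode; move: gaugeG => G; rewrite map_mxB map_mxM [in X in _ - X]map_mxM.
by rewrite gshift_mconst map_mxZ gshift_qA c_shift.
Qed.

Lemma shifted_ode_comb (X X' N N' G Z T : 'M[S]_n) :
  X' + X *m N' = N *m X -> T *m Z = Z *m T ->
  (X' *m G + X *m (N' *m G - G *m T)) *m Z = N *m (X *m G *m Z) - X *m G *m Z *m T.
Proof.
move=> E1 TZ; rewrite mulmxBr addrA !mulmxA -mulmxDl E1.
by rewrite mulmxBl -!mulmxA TZ.
Qed.

(** The operator x - z_i takes solutions at z^-_i to solutions at z, by
    compatibility; multiplication on the right by the constant diagonal matrix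
    [zetaV] preserves the equation as it commutes with U. *)
Lemma shifted_solution_ode (Y := (M - (z i)%:M) *m Gm *m zetaV) :
  D Y = B *m Y - Y *m U.
Proof.
have DZ : D zetaV = 0 by rewrite /zetaV mconstE gderiv_kmx.
have Dz : D ((z i)%:M : 'M_n) = 0.
  apply/matrixP => a b; rewrite !mxE; case: (a == b); rewrite ?mulr1n ?mulr0n ?raddf0 //.
  exact: gderiv_const.
have UZ : U *m zetaV = zetaV *m U.
  rewrite /zetaV !mconstE -!map_mxM; congr (map_mx _ (map_mx _ _)).
  exact: diag_mxC.
rewrite /Y gderiv_mulmx DZ mulmx0 addr0 gderiv_mulmx gshift_gaugeG_ode.
rewrite map_mxB Dz subr0.
exact: (shifted_ode_comb Gm (qDE_qKZ_compat C i) UZ).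
Qed.

(** Only s_1(z) depends on z_i, with coefficient 1. So the shift of z_i
    contributes a factor 1/s to s^Lambda, which cancels the growth of x - z_i.
    *)
Lemma ztrans_Lambda : ztrans (-1) i Lam = Lam - 1.
Proof.
rewrite /Lambda ztransD ztransC mesym1E [RHS]addrAC; congr (_ + _).
rewrite (big_morph _ (ztransD (-1) i) (ztrans0 (-1) i)).
under eq_bigr => k _ do rewrite ztrans_down_X.
rewrite big_split /= sumrN; congr (_ - _).
by rewrite (bigD1 i) //= eqxx big1 ?addr0 // => k /negPf ->.
Qed.

Lemma gshift_gaugeG :
  Gm = (gpow Lam * gpow (-1)) *: (H *m mconst V *m map_mx (gshift i) P).
Proof.
rewrite gaugeGE map_mxZ !map_mxM -gpowD.
have -> : (gshift i : {rmorphism S -> S}) (gpow Lam) = gpow (Lam - 1).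
  by rewrite -[LHS]/(gshift i (gmono 1 Lam)) gshift_mono ztrans1 ztrans_Lambda.
have -> : map_mx (gshift i) H = H.
  apply/matrixP => a b; rewrite !mxE; case: (a == b); last by rewrite !mulr0n rmorph0.
  rewrite !mulr1n calH_entry -[LHS]/(gshift i (gmono 1 (- a%:R))) gshift_mono.
  by rewrite ztrans1 ztransN ztrans_nat.
by rewrite gshift_mconst.
Qed.

Lemma gpow_scaleI (l : K) : injective (fun X : 'M[S]_n => gpow l *: X).
Proof.
move=> X Y /(congr1 (fun X => gpow (- l) *: X)).
by rewrite !scalerA -gpowD addNr !scale1r.
Qed.

Lemma conj_comb (X Y N W Q Q' Z A : 'M[S]_n) (t l : S) :
  t *: (X *m Y) = Y *m N ->
  X *m ((l * t) *: (Y *m W *m Q')) *m Z = l *: (Y *m W *m Q) *m A ->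
  l *: (Y *m (N *m W *m Q' *m Z)) = l *: (Y *m (W *m Q *m A)).
Proof.
move=> XY XE; rewrite !mulmxA -XY [RHS]scalemxAl -XE -scalemxAr -!scalemxAl scalerA.
by rewrite !mulmxA.
Qed.

(** After dividing by H and s^Lambda both sides are power series in 1/s, and
    only their constant terms matter: on the left that of x / s, diagonalized
    by E into the powers w^a, times the diagonal matrix of the w^(-a); on the
    right A. *)
Lemma gauge_ratio_eq1 (A : 'M[K]_n) :
  (M - (z i)%:M) *m Gm *m zetaV = gaugeG *m kmx A -> A = 1%:M.
Proof.
rewrite gshift_gaugeG gaugeGE.
have MH : gpow (-1) *: (M *m H) = H *m mpowser (@qA_inf C n).
  by rewrite qA_calH scalerA -gpowD addNr scale1r.
pose N k := qA_inf C n k + if k == 1%N then - ('X_i : K)%:M else 0.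
have MzH : gpow (-1) *: ((M - (z i)%:M) *m H) = H *m mpowser N.
  have -> : mpowser N = mpowser (@qA_inf C n) - gpow (-1) *: (z i)%:M.
    have -> : (z i)%:M = kmx (('X_i : K)%:M : 'M[K]_n) by rewrite map_scalar_mx.
    rewrite -scalerN -map_mxN kmxE gpow_mpowser mpowserD; apply: eq_mpowser.
    by case=> [|[|k]].
  rewrite mulmxBl scalerBr MH mulmxBr; congr (_ - _).
  by rewrite mul_scalar_mx -scalemxAr mul_mx_scalar.
(* N is the expansion of s^(-1) H^(-1) (x - z_i) H; its constant term is that
   of x. *)
move: MzH; move: (M - (z i)%:M) => X MzH E1.
have {E1} : mpowser N *m mconst V *m map_mx (gshift i) P *m zetaV
    = mconst V *m P *m kmx A.
  apply: (can_inj (mulKmx calH_unit)); apply: (@gpow_scaleI Lam).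
  exact: conj_comb MzH E1.
move=> /(congr1 (mulmx (mconst E))); rewrite !mulmxA mconst_EV mul1mx.
rewrite gshift_mpowser /zetaV !mconstE kmx_mpowser !mpowser_kmx mpowserM mpowser_kmx.
move=> /mpowser_inj /(_ 0%N); rewrite big_ord1 subnn F0 mul1mx => <-.
have N0 : N ord0 = qA_inf C n 0 by rewrite /N /= addr0.
rewrite N0 conj_qA_inf0.
have -> : map_mx (ztrans (-1) i) 1%:M = 1%:M :> 'M[K]_n.
  by apply/matrixP => a b; rewrite !mxE ztrans_nat.
rewrite mulmx1 -map_mxM mulmx_diag -(map_mx1 (@mpolyC n C)); congr map_mx.
apply/matrixP => a b; rewrite !mxE divff // expf_neq0 //.
Qed.

Lemma conj_inverse_comb (X Y G Z : 'M[S]_n) : G \in unitmx -> Y *m X = 1%:M ->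
  invmx G *m Y *m (X *m G *m Z) = Z.
Proof.
move=> Gu YX; rewrite -mulmxA (mulmxA Y) (mulmxA Y) YX mul1mx.
by rewrite mulKmx.
Qed.

(** By [gauge_ratio] and [gauge_ratio_eq1], G = (x - z_i) G^- Z; apply
    Ktilde_i, the inverse of x - z_i. *)
Lemma Ktilde_gauge : invmx Gm *m Ktilde i (gs ^+ n) z *m gaugeG = zetaV.
Proof.
have [A YE] := gauge_ratio eigU_inj gaugeG_unit gaugeG_ode shifted_solution_ode.
have q_unit : (gs ^+ n : S) \is a GRing.unit by rewrite gsX gpow_unit.
have Gm_unit : Gm \in unitmx by rewrite unitmxE det_map_mx rmorph_unit // -unitmxE gaugeG_unit.
have A1 := gauge_ratio_eq1 YE; rewrite A1 map_mx1 mulmx1 in YE.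
rewrite -[X in _ *m X = _]YE.
exact: (conj_inverse_comb zetaV Gm_unit (Ktilde_mul_qA_sub z i q_unit)).
Qed.

End Transformation.

Lemma gauge_transform_comb (S : comUnitRingType) n (G DG N T : 'M[S]_n) :
  G \in unitmx -> DG = N *m G - G *m T -> invmx G *m N *m G - invmx G *m DG = T.
Proof.
move=> Gu ->; rewrite -mulmxA -mulmxBr opprB addrC subrK.
by rewrite mulKmx.
Qed.

Lemma qDE_ode (C : numFieldType) n : (0 < n)%N ->
  ode (qDE_qKZ C n) = (n%:R * gpow (-1)) *: qA (gs ^+ n) (@zser C n).
Proof.
move=> n0; have E : n%:R * gs ^+ n.-1 * (gs ^+ n)^-1 = n%:R * gpow (-1) :> gseries C n.
  rewrite -mulrA !gsX gpowV -gpowD natr_pred //.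
  by congr (_ * gpow _); ring.
by rewrite -E -scalerA.
Qed.

Section Main.
Variables (C : numFieldType) (n : nat) (E : 'M[C]_n) (w : C).

(** The transformation for any matrix that diagonalizes the cyclic permutation
    matrix and whose entries satisfy E_ak (E^(-1))_ka = 1/n. *)
Lemma joint_system_transforms : (0 < n)%N -> w != 0 ->
  (forall a b : 'I_n, w ^+ a = w ^+ b -> a = b) -> E \in unitmx ->
  E *m cyclic_mx n C = diag_mx (\row_a w ^+ a) *m E ->
  (forall a k, E a k * invmx E k a = n%:R^-1) ->
  exists F : nat -> 'M[{mpoly C[n]}]_n, F 0%N = 1%:M /\
    transforms (calH C n *m mconst (invmx E) *m mpowser F *m (gpow (Lambda C n))%:M)
      (qDE_qKZ C n)
      (JointSystem (mconst (diag_mx (\row_a (n%:R * w ^+ a))))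
                   (fun=> mconst (diag_mx (\row_a w ^- a)))).
Proof.
move=> n0 w0 w_inj Eu Ec Ed.
have [F [F0 DF]] := formal_solution_exists n0 w_inj Eu Ec Ed.
exists F; split; first exact: F0.
have Gu := gaugeG_unit Eu F0.
split; first exact: Gu.
- rewrite -[RHS]/(mconst (diag_mx (eigU n w))) -/(gaugeG E F).
  rewrite qDE_ode //; exact: gauge_transform_comb Gu (gaugeG_ode Eu DF).
- by move=> j; exact: Ktilde_gauge.
Qed.

End Main.

Theorem theorem9p2 (R : realType) (n : nat) (n_ge2 : (2 <= n)%N) :
  exists F : nat -> 'M[{mpoly R[i][n]}]_n,
    F 0%N = 1%:M /\
    transforms
      (calH R[i] n *m mconst (invmx (calE R n)) *m mpowser F
         *m (gpow (Lambda R[i] n))%:M)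
      (qDE_qKZ R[i] n)
      (diagonal_system R n).
Proof.
have n_gt0 : (0 < n)%N by exact: ltnW.
apply: (@joint_system_transforms R[i] n (calE R n) (zeta R n)) => //.
- exact: zeta_neq0.
- exact: zeta_inj.
- exact: calE_unit.
- exact: calE_cyclic.
- exact: calE_mul_invmx.
Qed.
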